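(* Assume the standing assumptions (A) on $p,Q,r,s$ hold and that the preminimal operator $\mathrm{L}_{00}$ is bounded from below in $L^2(\mathbb{R})$. Suppose there is a sequence of intervals $\Delta_n=[a_n,b_n]$, $n\in\mathbb{Z}$, with $-\infty<a_n<b_n<\infty$, $b_n\to-\infty$ as $n\to-\infty$, $a_n\to\infty$ as $n\to\infty$, such that (i) $p_n:=p|_{\Delta_n}\in W^1_2(\Delta_n)$ and $p_n>0$ on $\Delta_n$; (ii) there is $C>0$ with $p_n(x)\le C|\Delta_n|^2$ for all $x\in\Delta_n$ and all $n\in\mathbb{Z}$, where $|\Delta_n|=b_n-a_n$. Then $\mathrm{L}_{00}$ is essentially self-adjoint and $\mathrm{L}_{00}^*=\mathrm{L}=\mathrm{L}^*$.
   Context: Standing assumptions (A): $p,Q,r,s:\mathbb{R}\to\mathbb{R}$ are real-valued measurable functions with $\frac{1}{\sqrt{|p|}},\frac{Q}{\sqrt{|p|}},\frac{r}{\sqrt{|p|}}\in L^2_{loc}(\mathbb{R})$, $s\in L^1_{loc}(\mathbb{R})$, $\frac1p\neq0$ a.e.; set $q=Q'+s$ (distributional derivative). Quasi-derivatives: $u^{[0]}:=u$, $u^{[1]}:=pu'-(Q+ir)u$, $u^{[2]}:=(u^{[1]})'+\frac{Q-ir}{p}u^{[1]}+\left(\frac{Q^2+r^2}{p}-s\right)u$, and $l[u]:=-u^{[2]}$ for $u$ with $u,u^{[1]}\in\mathrm{AC}_{loc}(\mathbb{R})$ (this realizes $-(pu')'+qu+i((ru)'+ru')$). Maximal operator: $\mathrm{L}u:=l[u]$,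 $\mathrm{Dom}(\mathrm{L}):=\{u\in L^2(\mathbb{R}): u,u^{[1]}\in\mathrm{AC}_{loc}(\mathbb{R}),\ l[u]\in L^2(\mathbb{R})\}$. Preminimal operator $\mathrm{L}_{00}$: restriction of $\mathrm{L}$ to compactly supported elements of $\mathrm{Dom}(\mathrm{L})$. Bounded from below means: $\exists\gamma\in\mathbb{R}$ with $(\mathrm{L}_{00}u,u)\ge\gamma\|u\|^2$ for all $u\in\mathrm{Dom}(\mathrm{L}_{00})$. *)

(* Defs.v *)
From HB Require Import structures.
From mathcomp Require Import all_boot all_order all_algebra.
From mathcomp Require Import all_classical all_reals all_analysis.
From mathcomp Require Import complex.
Import Order.TTheory GRing.Theory Num.Theory.
Import numFieldNormedType.Exports.
Local Open Scope classical_set_scope.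
Local Open Scope ring_scope.

Set Implicit Arguments. Unset Strict Implicit. Unset Printing Implicit Defensive.

Section SturmLiouville.
Variable R : realType.
Local Notation mu := (@lebesgue_measure R).
Local Notation Cf := (R -> R[i]).

Definition Lloc1 (f : R -> R) : Prop :=
  measurable_fun setT f /\ forall a b : R, mu.-integrable `[a, b] (EFin \o f).

Definition Lloc2 (f : R -> R) : Prop :=
  measurable_fun setT f /\ Lloc1 (fun x => f x ^+ 2).

Definition L2on (D : set R) (f : R -> R) : Prop :=
  measurable_fun D f /\ mu.-integrable D (EFin \o (fun x => f x ^+ 2)).

(* g is an L^1_loc derivative of f, i.e. f is locally absolutely continuous
   with f' = g a.e. *)
Definition ACloc (f g : R -> R) : Prop :=
  Lloc1 g /\
  forall x y : R, x <= y ->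
    (\int[mu]_(t in `[x, y]) (g t)%:E)%E = (f y - f x)%:E.

Definition reF (u : Cf) : R -> R := fun x => complex.Re (u x).
Definition imF (u : Cf) : R -> R := fun x => complex.Im (u x).

Definition L2 (u : Cf) : Prop := L2on setT (reF u) /\ L2on setT (imF u).

Definition AClocC (u du : Cf) : Prop :=
  ACloc (reF u) (reF du) /\ ACloc (imF u) (imF du).

Definition ae_eq (u v : Cf) : Prop := {ae mu, forall x, u x = v x}.

(* inner product (u, v) = \int u * conj v  in L^2(R) *)
Definition ip (u v : Cf) : R[i] :=
  Complex
    (Rintegral mu setT (fun x => reF u x * reF v x + imF u x * imF v x))
    (Rintegral mu setT (fun x => imF u x * reF v x - reF u x * imF v x)).

Definition nrm2 (u : Cf) : R :=
  Rintegral mu setT (fun x => reF u x ^+ 2 + imF u x ^+ 2).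

(* ---------- (possibly multivalued) operators in L^2, given by graphs ---------- *)
Definition graph := Cf -> Cf -> Prop.

Definition op_eq (G H : graph) : Prop :=
  (forall u f, G u f -> exists u' f', H u' f' /\ ae_eq u u' /\ ae_eq f f') /\
  (forall u f, H u f -> exists u' f', G u' f' /\ ae_eq u u' /\ ae_eq f f').

Definition adj (G : graph) : graph := fun v w =>
  L2 v /\ L2 w /\ forall u f, G u f -> ip f v = ip u w.

Definition clos (G : graph) : graph := fun u f =>
  L2 u /\ L2 f /\
  exists (us fs : nat -> Cf),
    (forall k, G (us k) (fs k)) /\
    (fun k => nrm2 (fun x => us k x - u x)) @ \oo --> (0 : R) /\
    (fun k => nrm2 (fun x => fs k x - f x)) @ \oo --> (0 : R).

Definition self_adjoint (G : graph) : Prop := op_eq G (adj G).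

Definition ess_self_adjoint (G : graph) : Prop := self_adjoint (clos G).

Definition RC (x : R) : R[i] := Complex x 0.

(* Maximal operator L:  (u, f) in the graph iff u in Dom(L) and f = l[u] a.e.
   du = u' (a.e.),  u1 = u^[1] (AC representative),  du1 = (u^[1])'. *)
Definition Lmax (p Q r s : R -> R) : graph := fun u f =>
  L2 u /\ L2 f /\
  exists du u1 du1 : Cf,
    AClocC u du /\ AClocC u1 du1 /\
    ae_eq u1 (fun x => RC (p x) * du x - (RC (Q x) + 'i * RC (r x)) * u x) /\
    ae_eq f (fun x => - (du1 x
                         + (RC (Q x) - 'i * RC (r x)) / RC (p x) * u1 x
                         + RC ((Q x ^+ 2 + r x ^+ 2) / p x - s x) * u x)).

Definition L00 (p Q r s : R -> R) : graph := fun u f =>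
  Lmax p Q r s u f /\ exists M : R, forall x, M < `|x| -> u x = 0.

Definition standing_A (p Q r s : R -> R) : Prop :=
  measurable_fun setT p /\ measurable_fun setT Q /\
  measurable_fun setT r /\ measurable_fun setT s /\
  Lloc2 (fun x => 1 / Num.sqrt `|p x|) /\
  Lloc2 (fun x => Q x / Num.sqrt `|p x|) /\
  Lloc2 (fun x => r x / Num.sqrt `|p x|) /\
  Lloc1 s /\
  {ae mu, forall x, p x != 0}.

Definition bounded_below (G : graph) : Prop :=
  exists gamma : R, forall u f, G u f ->
    complex.Im (ip f u) = 0 /\ gamma * nrm2 u <= complex.Re (ip f u).

End SturmLiouville.

(* Main.v *)
Require Import Defs.
From HB Require Import structures.
From mathcomp Require Import all_boot all_order all_algebra.
From mathcomp Require Import all_classical all_reals all_analysis.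
From mathcomp Require Import complex.
From mathcomp Require Import measurable_realfun ring lra.
Import Order.TTheory GRing.Theory Num.Theory.
Import numFieldNormedType.Exports.
Local Open Scope classical_set_scope.
Local Open Scope ring_scope.

Set Implicit Arguments. Unset Strict Implicit. Unset Printing Implicit Defensive.

(** A Povzner-Wienholtz argument.  The gauge exp(i theta) with theta' = r / p
    removes the first order terms in r, so that the real and imaginary parts
    decouple into real solutions of one quasi-differential system.  If
    l[v] = f with v and f square integrable, and phi is a cut-off function
    whose derivative lives on two of the intervals Delta_n, then
      (l[phi v], phi v) = int phi^2 f v + int p phi'^2 v^2,
    and p phi'^2 is bounded by a multiple of C because p <= C |Delta_n|^2.
    Hence the lower bound of the preminimal operator passes to the maximal one:
    after a shift of the spectral parameter, |v| <= |l[v]| on the whole maximal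
    domain.  In particular no nonzero solution of l[y] = 0 is square integrable.
    The functions of compact support in the range of the preminimal operator
    are those orthogonal to the two solutions of l[y] = 0, and since these are
    not square integrable the orthogonality can be achieved by an arbitrarily
    small correction supported in a large interval.  So the range is dense, and
    by the a priori estimate the maximal operator is contained in the closure of
    the preminimal one. *)

(** * Locally integrable and locally absolutely continuous functions *)

(** One obstacle determines how the intervals enter. The quasi-derivative of phi v is phi v^[1] + p
    phi' v; it has to be absolutely continuous, and l[phi v] square integrable. Off the intervals p
    is merely measurable and may change sign, so phi may vary only inside them; there the W^1_2
    condition makes (p phi')' square integrable. A ramp of height 1 over [Delta_n] has p phi'^2 of
    order p / |Delta_n|^2, which is the origin of condition (ii). Boundedness of this quantity
    suffices, without decay, because it multiplies only the mass of v outside [-M, M], a vanishing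
    tail. Density of the range is established by explicit approximants with controlled error, not by
    showing an orthogonal complement trivial; the a priori estimate then turns closeness of the
    images into closeness of the elements. The inclusion of L_00^* in L is a separate, local
    regularity statement: for (v, w) in the adjoint and a particular solution v0 of l[v0] = w, the
    difference v - v0 is forced on every [-m, m] into the two-dimensional solution space, and the
    coefficients found on different intervals agree. *)

Section Lloc1.
Variable R : realType.
Local Notation mu := (@lebesgue_measure R).
Implicit Types (f g h : R -> R) (a b x y : R).

Lemma ae_imp (P Q : set R) : (forall x, P x -> Q x) ->
  {ae mu, forall x, P x} -> {ae mu, forall x, Q x}.
Proof. by apply: filterS; exact: (ae_filter_ringOfSetsType mu). Qed.

Lemma ae_conj (P Q : set R) : {ae mu, forall x, P x} -> {ae mu, forall x, Q x} ->
  {ae mu, forall x, P x /\ Q x}.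
Proof. by apply: filterI; exact: (ae_filter_ringOfSetsType mu). Qed.

Lemma continuous_bounded_itv h a b : continuous h ->
  exists M : R, forall x, a <= x <= b -> `|h x| <= M.
Proof.
move=> ch; have : compact (h @` `[a, b]).
  apply: continuous_compact; last exact: segment_compact.
  exact: continuous_subspaceT.
move/compact_bounded => [M [_ HM]]; exists (M + 1) => x xab.
apply: (HM (M + 1)); first by rewrite ltrDl.
by exists x => //=; rewrite in_itv.
Qed.

Lemma Lloc1_le f g : measurable_fun setT f -> Lloc1 g ->
  (forall x, `|f x| <= g x) -> Lloc1 f.
Proof.
move=> mf [mg ig] fg; split => // a b.
apply: (le_integrable _ _ _ (ig a b)) => //=.
  by apply/measurable_EFinP; exact: measurable_funTS.
by move=> x _ /=; rewrite lee_fin (le_trans (fg x))// ler_norm.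
Qed.

Lemma Lloc1D f g : Lloc1 f -> Lloc1 g -> Lloc1 (fun x => f x + g x).
Proof.
move=> [mf If] [mg ig]; split; first exact: measurable_funD.
by move=> a b; refine (integrableD _ (If a b) (ig a b)).
Qed.

Lemma Lloc1M h f : continuous h -> Lloc1 f -> Lloc1 (fun x => h x * f x).
Proof.
move=> ch [mf If]; have mh := continuous_measurable_fun ch.
split; first exact: measurable_funM.
move=> a b; have [M HM] := continuous_bounded_itv a b ch.
have : [bounded h x | x in `[a, b]]; last first.
  move=> bh; refine (@integrableMr _ _ _ mu _ _ h _ _ bh (If a b)) => //.
  exact: measurable_funTS.
exists M; split; first by rewrite num_real.
move=> x Mx y /=; rewrite in_itv/= => yab.
exact: (le_trans (HM _ yab) (ltW Mx)).
Qed.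

Lemma Lloc1Mr h f : continuous h -> Lloc1 f -> Lloc1 (fun x => f x * h x).
Proof.
by move=> ch If; under eq_fun do rewrite mulrC; exact: Lloc1M.
Qed.

Lemma Lloc1Z k f : Lloc1 f -> Lloc1 (fun x => k * f x).
Proof. by apply: Lloc1M => x; exact: cvg_cst. Qed.

Lemma Lloc1N f : Lloc1 f -> Lloc1 (fun x => - f x).
Proof. by move=> /(Lloc1Z (-1)); under eq_fun do rewrite mulN1r. Qed.

Lemma Lloc1B f g : Lloc1 f -> Lloc1 g -> Lloc1 (fun x => f x - g x).
Proof. by move=> If /Lloc1N; exact: Lloc1D. Qed.

Lemma Lloc1_cst k : Lloc1 (fun _ : R => k).
Proof.
split => // a b; apply: measurable_bounded_integrable => //.
  by rewrite [ltLHS]lebesgue_measure_itv/=; case: ifP => // _; rewrite -EFinB ltry.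
by exists `|k|; split; [rewrite num_real|move=> x kx y _; exact: ltW].
Qed.

Lemma Lloc1_continuous h : continuous h -> Lloc1 h.
Proof.
by move=> ch; have := Lloc1M ch (Lloc1_cst 1); under eq_fun do rewrite mulr1.
Qed.

Lemma Lloc1_norm f : Lloc1 f -> Lloc1 (fun x => `|f x|).
Proof.
move=> [mf If]; split; first exact: measurableT_comp.
by move=> a b; exact: integrable_norm.
Qed.

Lemma Lloc1_indic (A : set R) f : measurable A -> Lloc1 f ->
  Lloc1 (fun x => \1_A x * f x).
Proof.
move=> mA If; apply: (Lloc1_le _ (Lloc1_norm If)).
  by apply: measurable_funM => //; case: If.
by move=> x; rewrite indicE; case: (_ \in _); rewrite ?mul1r// mul0r normr0.
Qed.

Lemma Lloc2M f g : Lloc2 f -> Lloc2 g -> Lloc1 (fun x => f x * g x).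
Proof.
move=> [mf If] [mg Ig]; apply: (Lloc1_le _ (Lloc1D If Ig)).
  exact: measurable_funM.
by move=> x; rewrite ler_norml; apply/andP; split; nra.
Qed.

Lemma Lloc1_itv f a b : Lloc1 f -> mu.-integrable `[a, b] (EFin \o f).
Proof. by case. Qed.

Lemma Lloc1_ae_eq f g : Lloc1 f -> measurable_fun setT g ->
  {ae mu, forall x, f x = g x} -> Lloc1 g.
Proof.
move=> [mf If] mg fg; split => // a b.
apply/integrableP; split.
  by apply/measurable_EFinP; exact: measurable_funTS.
have /integrableP[_] := If a b; congr (_ < _)%E.
apply: ae_eq_integral => //=.
- by do 2 apply: measurableT_comp => //; exact: measurable_funTS.
- by do 2 apply: measurableT_comp => //; exact: measurable_funTS.
by apply: ae_imp fg => x /= -> _.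
Qed.

Lemma Rintegral_ae_eq (D : set R) f g : measurable D ->
  measurable_fun D f -> measurable_fun D g ->
  {ae mu, forall x, D x -> f x = g x} ->
  \int[mu]_(x in D) f x = \int[mu]_(x in D) g x.
Proof.
move=> mD mf mg fg; rewrite /Rintegral; congr fine.
apply: ae_eq_integral => //; try exact/measurable_EFinP.
by apply: ae_imp fg => x /= fgx Dx; rewrite fgx.
Qed.

Lemma Rintegral_itvD f a x b : Lloc1 f -> a <= x -> x <= b ->
  \int[mu]_(t in `[a, b]) f t
    = \int[mu]_(t in `[a, x]) f t + \int[mu]_(t in `[x, b]) f t.
Proof.
move=> If ax xb; apply/eqP; rewrite addrC -subr_eq; apply/eqP.
rewrite Rintegral_itvB ?bnd_simp//; last exact: Lloc1_itv.
rewrite -Rintegral_itv_obnd_cbnd//.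
apply: integrableS (Lloc1_itv x b If) => //.
by apply: subset_itvr; rewrite bnd_simp.
Qed.

Lemma Rintegral_itvxx f a : \int[mu]_(t in `[a, a]) f t = 0.
Proof. by rewrite set_itv1 Rintegral_set1. Qed.

End Lloc1.

(** * Calculus of locally absolutely continuous functions *)

Section AC.
Variable R : realType.
Local Notation mu := (@lebesgue_measure R).
Implicit Types (f g h : R -> R) (a b x y : R).

Lemma ACloc_Rintegral f g x y : ACloc f g -> x <= y ->
  \int[mu]_(t in `[x, y]) g t = f y - f x.
Proof. by move=> [_ fg] xy; rewrite /Rintegral fg. Qed.

Lemma ACloc_intro f g : Lloc1 g ->
  (forall x y, x <= y -> \int[mu]_(t in `[x, y]) g t = f y - f x) -> ACloc f g.
Proof.
move=> Ig fg; split => // x y xy; rewrite -fg// fineK//.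
by apply: (integrable_fin_num _ (Lloc1_itv x y Ig)).
Qed.

Lemma ACloc_Lloc1 f g : ACloc f g -> Lloc1 g.
Proof. by case. Qed.

Lemma ACloc_continuous f g : ACloc f g -> continuous f.
Proof.
move=> fg x; have Ig := ACloc_Lloc1 fg.
have ab : x - 1 < x + 1 by lra.
have := parameterized_integral_continuous (ltW ab) (Lloc1_itv _ _ Ig).
move=> /(continuous_within_itvP _ ab)[+ _ _] => /(_ x).
rewrite in_itv/= ltrBlDr ltrDl ltr01/= => /(_ isT) cx.
have -> : f = (fun y => (f y - f (x - 1)) + f (x - 1)).
  by apply/funext => y; rewrite subrK.
apply: cvgD; last exact: cvg_cst.
rewrite -(ACloc_Rintegral fg); last by lra.
apply: cvg_trans cx; apply: near_eq_cvg.
have : \forall y \near x, x - 1 <= y.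
  by apply: filterS (lt_nbhsr _ : \forall y \near x, x - 1 < y) => [y /ltW//|]; lra.
apply: filterS => y xy.
by rewrite /parameterized_integral -(ACloc_Rintegral fg).
Qed.

Lemma ACloc_ae_eq f g g' : ACloc f g -> measurable_fun setT g' ->
  {ae mu, forall x, g x = g' x} -> ACloc f g'.
Proof.
move=> fg mg' gg'; have Ig := ACloc_Lloc1 fg.
apply: ACloc_intro; first exact: Lloc1_ae_eq gg'.
move=> x y xy; rewrite -(ACloc_Rintegral fg xy); apply: Rintegral_ae_eq => //.
- exact: measurable_funTS.
- by apply: measurable_funTS; case: Ig.
- by apply: ae_imp gg' => t -> _.
Qed.

Lemma ACloc_eq f g f' g' : f =1 f' -> g =1 g' -> ACloc f g -> ACloc f' g'.
Proof. by move=> /funext -> /funext ->. Qed.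

Lemma ACloc_cst k : ACloc (fun _ : R => k) (fun _ => 0).
Proof.
apply: ACloc_intro; first exact: Lloc1_cst.
by move=> x y xy; rewrite Rintegral_cst// mul0r subrr.
Qed.

Lemma AClocD f1 g1 f2 g2 : ACloc f1 g1 -> ACloc f2 g2 ->
  ACloc (fun x => f1 x + f2 x) (fun x => g1 x + g2 x).
Proof.
move=> h1 h2; have [I1 I2] := (ACloc_Lloc1 h1, ACloc_Lloc1 h2).
apply: ACloc_intro; first exact: Lloc1D.
move=> x y xy; rewrite RintegralD//; [|exact: Lloc1_itv|exact: Lloc1_itv].
by rewrite (ACloc_Rintegral h1)// (ACloc_Rintegral h2)//; ring.
Qed.

Lemma AClocZ k f g : ACloc f g -> ACloc (fun x => k * f x) (fun x => k * g x).
Proof.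
move=> h; have I1 := ACloc_Lloc1 h; apply: ACloc_intro; first exact: Lloc1Z.
move=> x y xy; rewrite RintegralZl//; last exact: Lloc1_itv.
by rewrite (ACloc_Rintegral h)// mulrBr.
Qed.

Lemma AClocN f g : ACloc f g -> ACloc (fun x => - f x) (fun x => - g x).
Proof.
by move=> /(AClocZ (-1)); apply: ACloc_eq => x; rewrite mulN1r.
Qed.

Lemma AClocB f1 g1 f2 g2 : ACloc f1 g1 -> ACloc f2 g2 ->
  ACloc (fun x => f1 x - f2 x) (fun x => g1 x - g2 x).
Proof. by move=> h1 /AClocN; exact: AClocD. Qed.

Lemma ACloc0_const f : ACloc f (fun _ => 0) -> forall x y, f x = f y.
Proof.
move=> h; suff H x y : x <= y -> f x = f y.
  by move=> x y; case/orP: (le_total x y) => /H.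
move=> xy; have := ACloc_Rintegral h xy.
by rewrite Rintegral_cst// mul0r => /eqP; rewrite eq_sym subr_eq0 => /eqP.
Qed.

(** The case distinction supplies the orientation: an integral over the set [0, x] would be 0 for
    negative x. *)
Definition prim g x : R :=
  if 0 <= x then \int[mu]_(t in `[0, x]) g t else - \int[mu]_(t in `[x, 0]) g t.

Lemma prim0 g : prim g 0 = 0.
Proof. by rewrite /prim lexx Rintegral_itvxx. Qed.

Lemma ACloc_prim g : Lloc1 g -> ACloc (prim g) g.
Proof.
move=> Ig; apply: ACloc_intro => // x y xy; rewrite /prim.
case: leP => y0; case: leP => x0.
- by rewrite (Rintegral_itvD Ig x0 xy); ring.
- by rewrite (Rintegral_itvD Ig (ltW x0) y0); ring.
- by have := lt_le_trans y0 (le_trans x0 xy); rewrite ltxx.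
- by rewrite (Rintegral_itvD Ig xy (ltW y0)); ring.
Qed.

(** Lebesgue differentiation identifies [g] almost everywhere with the derivative of its primitive
    from a, and on (a, b) this primitive is the constant - f a. *)
Lemma ACloc_zero_ae f g a b : ACloc f g -> (forall x, a < x < b -> f x = 0) ->
  {ae mu, forall x, a < x < b -> g x = 0}.
Proof.
move=> fg f0; have Ig := ACloc_Lloc1 fg.
have lg : locally_integrable setT g.
  split; [by case: Ig|exact: openT|].
  move=> K _ cK; have [M [_ HM]] := compact_bounded cK.
  have KM : K `<=` `[- (M + 1), M + 1].
    move=> x Kx /=; rewrite in_itv/= -ler_norml.
    by apply: (HM (M + 1)) => //; rewrite ltrDl.
  have /integrableP[_] : mu.-integrable K (EFin \o g).
    refine (@integrableS _ _ _ mu _ _ _ _ _ KM (Lloc1_itv _ _ Ig)) => //.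
    exact: compact_measurable.
  by [].
have /FTC1 : forall y, mu.-integrable [set` Interval (BLeft a) (BRight y)] (EFin \o g).
  by move=> y; exact: Lloc1_itv.
move=> /(_ lg); apply: ae_imp => x /= + /andP[ax xb].
rewrite lte_fin => /(_ ax)[_ <-].
set F := fun y => _.
have : \forall y \near x, F y = - f a.
  have H : \forall y \near x, a < y < b.
    by near=> y; apply/andP; split; near: y; [exact: lt_nbhsr|exact: lt_nbhsl].
  apply: filterS H => y /andP[ay yb].
  by rewrite /F (ACloc_Rintegral fg) ?(ltW ay)// f0 ?ay// sub0r.
move=> Fc; rewrite derive1E (near_eq_derive (g := cst (- f a))) ?oner_eq0//.
by rewrite derive_cst.
Unshelve. all: by end_near. Qed.

(* Fubini on the triangle [a <= y <= x <= b]. *)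
Lemma triangle_swap g1 f1 g2 f2 a b : ACloc f1 g1 -> ACloc f2 g2 -> a <= b ->
  \int[mu]_(x in `[a, b]) (g1 x * (f2 x - f2 a)) =
  \int[mu]_(y in `[a, b]) (g2 y * (f1 b - f1 y)).
Proof.
move=> h1 h2 ab; have [I1 I2] := (ACloc_Lloc1 h1, ACloc_Lloc1 h2).
have [m1 m2] : measurable_fun setT g1 /\ measurable_fun setT g2.
  by split; [case: I1|case: I2].
pose D := `[a, b]%classic : set R.
have mD : measurable D by exact: measurable_itv.
pose k (z : R * R) : R :=
  if z.2 <= z.1 then (\1_D z.1 * g1 z.1) * (\1_D z.2 * g2 z.2) else 0.
have mk : measurable_fun setT k.
  apply: measurable_fun_ifT => //.
  - by apply: measurable_fun_ler.
  - have mG (g : R -> R) : measurable_fun setT g ->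
        measurable_fun setT (fun x => \1_D x * g x).
      by move=> mg; exact: measurable_funM.
    apply: measurable_funM.
    + exact: measurableT_comp (mG _ m1) measurable_fst.
    + exact: measurableT_comp (mG _ m2) measurable_snd.
have E1 x : (\int[mu]_y (k (x, y))%:E)%E = ((\1_D x) * (g1 x * (f2 x - f2 a)))%:E.
  rewrite indicE; have [xD|xD] := boolP (x \in D); last first.
    rewrite mul0r integral0_eq// => y _.
    by rewrite /k/= indicE (negbTE xD) !mul0r if_same.
  move: xD; rewrite inE /D/= in_itv/= => /andP[ax xb].
  rewrite mul1r -(ACloc_Rintegral h2 ax) -RintegralZl//; last exact: Lloc1_itv.
  rewrite fineK; last first.
    by apply: (integrable_fin_num _ (Lloc1_itv _ _ (Lloc1Z (g1 x) I2))).
  rewrite [RHS]integral_mkcond; apply: eq_integral => y _.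
  rewrite /k/= patchE !indicE !mem_setE /D !in_itv/= ax xb mul1r.
  case: (leP y x) => yx; last by rewrite andbF.
  by rewrite (le_trans yx xb) andbT; case: (a <= y); rewrite ?mul1r// mul0r mulr0.
have E2 y : (\int[mu]_x (k (x, y))%:E)%E = ((\1_D y) * (g2 y * (f1 b - f1 y)))%:E.
  rewrite indicE; have [xD|xD] := boolP (y \in D); last first.
    rewrite mul0r integral0_eq// => x _.
    by rewrite /k/= [X in _ * (X * _)]indicE (negbTE xD) mul0r mulr0 if_same.
  move: xD; rewrite inE /D/= in_itv/= => /andP[ay yb].
  rewrite mul1r -(ACloc_Rintegral h1 yb) -RintegralZl//; last exact: Lloc1_itv.
  rewrite fineK; last first.
    by apply: (integrable_fin_num _ (Lloc1_itv _ _ (Lloc1Z (g2 y) I1))).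
  rewrite [RHS]integral_mkcond; apply: eq_integral => x _.
  rewrite /k/= patchE !indicE !mem_setE /D !in_itv/= ay yb mul1r.
  case: (leP y x) => yx//=.
  rewrite (le_trans ay yx)/=; case: (x <= b); first by rewrite mul1r mulrC.
  by rewrite !mul0r.
(* Tonelli: the kernel is dominated by |g1(x)| |g2(y)| on the square, and [N false] is the integral
   of |g2|. *)
have ik : (mu \x mu)%E.-integrable setT (EFin \o k).
  apply/integrable12ltyP; first exact/measurable_EFinP.
  pose N i := (\int[mu]_(y in D) `|(if i then g1 else g2) y|).
  have IN (g : R -> R) : Lloc1 g ->
      (\int[mu]_y `|\1_D y * g y|%:E)%E = (\int[mu]_(y in D) `|g y|)%:E.
    move=> Ig; rewrite fineK; last first.
      by apply: (integrable_fin_num _ (Lloc1_itv _ _ (Lloc1_norm Ig))).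
    rewrite [RHS]integral_mkcond; apply: eq_integral => y _.
    by rewrite patchE indicE; case: (_ \in _); rewrite ?mul1r// mul0r normr0.
  apply: (@le_lt_trans _ _ (\int[mu]_x (`|\1_D x * g1 x| * N false)%:E)%E).
    apply: ge0_le_integral => //.
    - by move=> x _; apply: integral_ge0.
    - refine (@measurable_fun_fubini_tonelli_F _ _ _ _ _ mu (fun z => `|(k z)%:E|%E) _ _) => //.
      by apply: measurableT_comp => //; exact/measurable_EFinP.
    - apply/measurable_EFinP; apply: measurable_funM => //.
      by apply: measurableT_comp => //; exact: measurable_funM.
    move=> x _; rewrite EFinM -IN// -ge0_integralZl//=.
    - apply: ge0_le_integral => //.
      + apply/measurable_EFinP; apply: measurableT_comp => //.
        by apply: measurableT_comp mk _; exact: measurable_pair1.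
      + apply/measurable_EFinP; apply: measurable_funM => //.
        apply: measurableT_comp => //; exact: measurable_funM.
      move=> y _; rewrite /k/= lee_fin; case: ifP => _; first by rewrite normrM.
      by rewrite normr0.
    - apply/measurable_EFinP; apply: measurableT_comp => //.
      exact: measurable_funM.
  under eq_integral do rewrite EFinM.
  rewrite ge0_integralZr//; last 2 first.
  - apply/measurable_EFinP; apply: measurableT_comp => //.
    exact: measurable_funM.
  - by rewrite lee_fin; apply: Rintegral_ge0 => y _.
  by rewrite IN// -EFinM ltry.
have /= := Fubini ik.
under eq_integral do rewrite E1; under [in RHS]eq_integral do rewrite E2.
have R1 (g : R -> R) : \int[mu]_(x in D) g x = fine (\int[mu]_x (\1_D x * g x)%:E)%E.
  rewrite /Rintegral integral_mkcond; congr fine; apply: eq_integral => x _.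
  by rewrite patchE indicE; case: (_ \in _); rewrite ?mul1r// mul0r.
by rewrite !R1 => ->.
Qed.

(** Expanding both sides of [triangle_swap] gives integration by parts, with the boundary terms
    coming from f2 a and f1 b. *)
Lemma AClocM f1 g1 f2 g2 : ACloc f1 g1 -> ACloc f2 g2 ->
  ACloc (fun x => f1 x * f2 x) (fun x => g1 x * f2 x + f1 x * g2 x).
Proof.
move=> h1 h2; have [I1 I2] := (ACloc_Lloc1 h1, ACloc_Lloc1 h2).
have [c1 c2] := (ACloc_continuous h1, ACloc_continuous h2).
have J1 : Lloc1 (fun x => g1 x * f2 x) by exact: Lloc1Mr.
have J2 : Lloc1 (fun x => f1 x * g2 x) by exact: Lloc1M.
apply: ACloc_intro; first exact: Lloc1D.
move=> x y xy; have := triangle_swap h1 h2 xy.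
under eq_Rintegral do rewrite mulrBr.
under [in RHS]eq_Rintegral do rewrite mulrBr [X in _ - X]mulrC.
rewrite !RintegralB ?RintegralZr ?RintegralD//; try exact: Lloc1_itv.
- by rewrite (ACloc_Rintegral h1 xy) (ACloc_Rintegral h2 xy) => H; lra.
- by apply: Lloc1_itv; apply: Lloc1Mr => // z; exact: cvg_cst.
- by apply: Lloc1_itv; apply: Lloc1Mr => // z; exact: cvg_cst.
Qed.

End AC.
(** * Linear systems with locally integrable coefficients *)

Section LinearSystem.
Variable R : realType.
Local Notation mu := (@lebesgue_measure R).
Implicit Types (f g h : R -> R) (x y : R).

Lemma ACloc_le f g F G x y : ACloc f g -> ACloc F G -> x <= y ->
  (forall t, x <= t <= y -> `|g t| <= G t) -> `|f y - f x| <= F y - F x.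
Proof.
move=> fg FG xy gG; rewrite -(ACloc_Rintegral fg xy) -(ACloc_Rintegral FG xy).
have [Ig IG] := (ACloc_Lloc1 fg, ACloc_Lloc1 FG).
apply: (le_trans (le_normr_Rintegral _ (Lloc1_itv _ _ Ig))) => //.
apply: le_Rintegral => //; first exact: Lloc1_itv (Lloc1_norm Ig).
- exact: Lloc1_itv.
Qed.

Lemma AClocX f g n : ACloc f g ->
  ACloc (fun x => f x ^+ n.+1) (fun x => n.+1%:R * g x * f x ^+ n).
Proof.
move=> fg; elim: n => [|n IHn].
  by apply: ACloc_eq fg => x; rewrite ?expr1// mul1r expr0 mulr1.
apply: ACloc_eq (AClocM fg IHn) => x; first by rewrite [RHS]exprS.
by rewrite -[n.+2%:R]natr1 exprS; ring.
Qed.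

Variables (a : bool -> bool -> R -> R) (c : bool -> R).
Hypothesis Ia : forall i j, Lloc1 (a i j).

Let rhs (u : bool -> R -> R) i x := a i true x * u true x + a i false x * u false x.

(** These are the increments between successive Picard iterates; the iterates themselves are the
    partial sums [Y] below. *)
Fixpoint picard_term k i : R -> R :=
  if k is k'.+1 then prim (rhs (picard_term k') i) else fun _ => c i.

Let m x : R := (`|a true true x| + `|a true false x|)
           + (`|a false true x| + `|a false false x|).
Let M := prim m.
Let C : R := `|c true| + `|c false|.

Let Im : Lloc1 m.
Proof. by apply: Lloc1D; apply: Lloc1D; exact: Lloc1_norm. Qed.

Let AM : ACloc M m. Proof. exact: ACloc_prim. Qed.

Let Irhs u i : (forall j, continuous (u j)) -> Lloc1 (rhs u i).
Proof. by move=> cu; apply: Lloc1D; apply: Lloc1Mr. Qed.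

Let picard_continuous k i : continuous (picard_term k i).
Proof.
elim: k i => [|k IHk] i /=; first by move=> x; exact: cvg_cst.
by apply: ACloc_continuous (ACloc_prim _); exact: Irhs.
Qed.

Let rhs_le u i x B : (forall j, `|u j x| <= B) -> `|rhs u i x| <= m x * B.
Proof.
move=> uB; have B0 : 0 <= B by exact: le_trans (uB true).
apply: (le_trans (ler_normD _ _)); rewrite !normrM /m.
have [uT uF] := (uB true, uB false).
have h b1 b2 : `|a b1 b2 x| * `|u b2 x| <= `|a b1 b2 x| * B.
  by rewrite ler_wpM2l//; case: b2.
have p b1 b2 : 0 <= `|a b1 b2 x| * B by rewrite mulr_ge0.
have := (h i true, h i false); case: i => -[];
have := (p true true, p true false, p false true, p false false).
- by case=> [[[? ?] ?] ?] ? ?; rewrite !mulrDl; lra.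
- by case=> [[[? ?] ?] ?] ? ?; rewrite !mulrDl; lra.
Qed.

Let m_ge0 x : 0 <= m x. Proof. by rewrite !addr_ge0. Qed.

Let M0 : M 0 = 0. Proof. exact: prim0. Qed.

Let M_ge0 x : 0 <= x -> 0 <= M x.
Proof.
move=> x0; have := ACloc_Rintegral AM x0; rewrite M0 subr0 => <-.
by apply: Rintegral_ge0 => t _; exact: m_ge0.
Qed.

Let M_le0 x : x <= 0 -> M x <= 0.
Proof.
move=> x0; rewrite -oppr_ge0.
have := ACloc_Rintegral AM x0; rewrite M0 sub0r => <-.
by apply: Rintegral_ge0 => t _; exact: m_ge0.
Qed.

Let factS k : (k.+1)`!%:R = k.+1%:R * k`!%:R :> R.
Proof. by rewrite factS natrM. Qed.

Let picard_le k i x : `|picard_term k i x| <= C * (`|M x| ^+ k / k`!%:R).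
Proof.
elim: k i x => [|k IHk] i x /=.
  by rewrite expr0 fact0 divr1 mulr1 /C; case: i; rewrite ?lerDl ?lerDr.
have AF : ACloc (prim (rhs (picard_term k) i)) (rhs (picard_term k) i).
  by apply: ACloc_prim; exact: Irhs.
have k0 : (k`!%:R : R) != 0 by rewrite pnatr_eq0 -lt0n fact_gt0.
have k1 : (k.+1%:R : R) != 0 by rewrite pnatr_eq0.
have -> : prim (rhs (picard_term k) i) x =
    prim (rhs (picard_term k) i) x - prim (rhs (picard_term k) i) 0.
  by rewrite prim0 subr0.
have [x0|/ltW x0] := leP 0 x.
(* The comparison function is C M^(k+1) / (k+1)!, whose derivative C m M^k / k! is exactly the bound
   given by the induction hypothesis. *)
- apply: le_trans (ACloc_le AF (AClocZ (C / (k.+1)`!%:R) (AClocX k AM)) x0 _) _.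
    2: by rewrite M0 expr0n mulr0 subr0 ger0_norm ?M_ge0// mulrA mulrAC.
  move=> t /andP[t0 _]; apply: (le_trans (rhs_le _ _)) => [j|]; first exact: IHk.
  rewrite ger0_norm ?M_ge0// factS le_eqVlt; apply/orP; left; apply/eqP.
  by move: (k.+1%:R : R) (k`!%:R : R) k0 k1 => A B A0 B0; field; rewrite A0 B0.
(* On the negative half-line M is negative, so the increasing comparison function is - C (- M)^(k+1)
   / (k+1)!. *)
- rewrite distrC.
  apply: le_trans (ACloc_le AF (AClocZ (- (C / (k.+1)`!%:R)) (AClocX k (AClocN AM))) x0 _) _.
    2: by rewrite M0 oppr0 expr0n mulr0 sub0r ler0_norm ?M_le0// mulNr opprK mulrA mulrAC.
  move=> t /andP[_ t0]; apply: (le_trans (rhs_le _ _)) => [j|]; first exact: IHk.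
  rewrite ler0_norm ?M_le0// factS le_eqVlt; apply/orP; left; apply/eqP.
  by move: (k.+1%:R : R) (k`!%:R : R) k0 k1 => A B A0 B0; field; rewrite A0 B0.
Qed.

Let Y n i x := series (picard_term^~ i ^~ x) n.

Let term_cvg i x : cvgn (series (picard_term^~ i ^~ x)).
Proof.
apply: normed_cvg; apply: (@series_le_cvg _ _ (fun k => C * (`|M x| ^+ k / k`!%:R))).
- by move=> n /=.
- by move=> n; rewrite mulr_ge0 ?addr_ge0// divr_ge0// exprn_ge0.
- by move=> n; exact: picard_le.
- by apply: is_cvg_seriesZ; exact: is_cvg_series_exp_coeff.
Qed.

Let Y_le n i x : `|Y n i x| <= C * expR `|M x|.
Proof.
rewrite /Y /series/=; apply: (le_trans (ler_norm_sum _ _ _)).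
apply: (@le_trans _ _ (\sum_(0 <= k < n) C * (`|M x| ^+ k / k`!%:R))).
  by apply: ler_sum => k _; exact: picard_le.
rewrite -mulr_sumr ler_wpM2l ?addr_ge0//.
apply: (nondecreasing_cvgn_le _ (is_cvg_series_exp_coeff _)).
apply/nondecreasing_seqP => k; rewrite /series/= big_nat_recr//= lerDl.
by rewrite divr_ge0// exprn_ge0.
Qed.

(** The index starts well: [Y 0] is the empty sum, so its right-hand side is 0, and [Y 1] is the
    constant initial value. *)
Let Y_AC n i : ACloc (Y n.+1 i) (rhs (Y n) i).
Proof.
elim: n => [|n IHn].
  apply: ACloc_eq (ACloc_cst (c i)) => x; first by rewrite /Y /series/= big_nat1.
  by rewrite /rhs /Y /series/= !big_geq// !mulr0 addr0.
have AF : ACloc (prim (rhs (picard_term n) i)) (rhs (picard_term n) i).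
  by apply: ACloc_prim; exact: Irhs.
apply: ACloc_eq (AClocD IHn AF) => x.
  by rewrite /Y /series/= [RHS]big_nat_recr.
rewrite /rhs /Y /series/= [\sum_(0 <= k < n.+1) picard_term k true x]big_nat_recr//=.
by rewrite [\sum_(0 <= k < n.+1) picard_term k false x]big_nat_recr//=; ring.
Qed.

(** With coefficients only in L^1_loc the role of the Lipschitz constant is taken by the primitive
    [M] of their absolute values. The Picard series is dominated by an exponential series, and the
    integral equation of the partial sums passes to the limit by dominated convergence, with
    majorant [C * expR B * m], where [B] bounds |M| on the interval. *)
Theorem linear_system_solution : exists u : bool -> R -> R,
  (forall i, u i 0 = c i) /\
  (forall i, ACloc (u i) (fun x => a i true x * u true x + a i false x * u false x)).
Proof.
pose u i x := limn (Y ^~ i ^~ x).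
have Yu i x : Y n i x @[n --> \oo] --> u i x by exact: term_cvg.
have cY n i : continuous (Y n i).
  case: n => [|n]; last exact: ACloc_continuous (Y_AC n i).
  rewrite (_ : Y 0 i = fun=> 0); first by move=> x; exact: cvg_cst.
  by apply/funext => x; rewrite /Y /series/= big_geq.
have mu_ i : measurable_fun setT (u i).
  apply: (@measurable_fun_cvg _ _ _ _ (Y ^~ i)) => [n|x _]; last exact: Yu.
  exact: continuous_measurable_fun.
have mrhs v i : (forall j, measurable_fun setT (v j)) -> measurable_fun setT (rhs v i).
  by move=> mv; apply: measurable_funD; apply: measurable_funM => //; exact: (Ia _ _).1.
have rhs_cvg i x : rhs (Y n) i x @[n --> \oo] --> rhs u i x.
  by apply: cvgD; apply: cvgM; (try exact: cvg_cst); exact: Yu.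
have dct x y i : mu.-integrable `[x, y] (EFin \o rhs u i) /\
    (fun n => \int[mu]_(t in `[x, y]) (rhs (Y n) i t)%:E)%E @ \oo -->
    (\int[mu]_(t in `[x, y]) (rhs u i t)%:E)%E.
  have [B HB] := continuous_bounded_itv x y (ACloc_continuous AM).
  have := @dominated_convergence _ _ _ mu `[x, y]%classic _
    (fun n t => (rhs (Y n) i t)%:E) (EFin \o rhs u i)
    (fun t => (C * expR B * m t)%:E).
  case=> //.
  - move=> n; apply/measurable_EFinP; apply: measurable_funTS.
    by apply: mrhs => j; exact: continuous_measurable_fun.
  - by apply/measurable_EFinP; apply: measurable_funTS; exact: mrhs.
  - apply: aeW => t _; apply: cvg_EFin; last exact: rhs_cvg.
    by apply: nearW.
  - exact: Lloc1_itv (Lloc1Z _ Im).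
  - apply: aeW => t n /=; rewrite in_itv => /HB tB; rewrite lee_fin mulrC.
    apply: rhs_le => j; apply: (le_trans (Y_le _ _ _)).
    by rewrite ler_wpM2l ?addr_ge0// ler_expR.
exists u; split=> i.
  have E n : Y n.+1 i 0 = c i.
    rewrite /Y /series/= big_nat_recl//= big1_seq ?addr0// => k _.
    by rewrite prim0.
  have H : (fun _ : nat => c i) @ \oo --> u i 0.
    rewrite (_ : (fun _ => _) = (fun n => Y n.+1 i 0)).
      by rewrite (cvg_shiftS (fun n => Y n i 0)); exact: Yu.
    by apply/funext => n; rewrite E.
  by apply: (cvg_unique _ H) => //; exact: cvg_cst.
apply: ACloc_intro.
  by split; [exact: mrhs|move=> x y; case: (dct x y i)].
move=> x y xy; have [Iu] := dct x y i.
rewrite -[in X in _ --> X -> _](@fineK _ (\int[mu]_(t in `[x, y]) (rhs u i t)%:E)); last first.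
  by apply: (integrable_fin_num _ Iu).
move=> /fine_cvgP[_ H]; apply: (cvg_unique _ H) => //.
rewrite (_ : _ \o _ = fun n => Y n.+1 i y - Y n.+1 i x).
  by apply: cvgB; rewrite (cvg_shiftS (Y ^~ i ^~ _)); exact: Yu.
by apply/funext => n /=; rewrite -(ACloc_Rintegral (Y_AC n i) xy).
Qed.

End LinearSystem.
(** * Square integrable functions *)

Section SquareIntegrable.
Variable R : realType.
Local Notation mu := (@lebesgue_measure R).
Implicit Types (f g h : R -> R) (D : set R) (a b x y : R).

Lemma integrableD_EFin D f g : measurable D -> mu.-integrable D (EFin \o f) ->
  mu.-integrable D (EFin \o g) -> mu.-integrable D (EFin \o (fun x => f x + g x)).
Proof. by move=> mD If Ig; refine (@integrableD _ _ _ mu _ mD _ _ If Ig). Qed.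

Lemma integrableZ_EFin D k f : measurable D -> mu.-integrable D (EFin \o f) ->
  mu.-integrable D (EFin \o (fun x => k * f x)).
Proof. by move=> mD If; refine (@integrableZl _ _ _ mu _ mD k _ If). Qed.

Lemma integrableB_EFin D f g : measurable D -> mu.-integrable D (EFin \o f) ->
  mu.-integrable D (EFin \o g) -> mu.-integrable D (EFin \o (fun x => f x - g x)).
Proof. by move=> mD If Ig; refine (@integrableB _ _ _ mu _ mD _ _ If Ig). Qed.

Lemma integrable_le_EFin D f g : measurable D -> measurable_fun D f ->
  mu.-integrable D (EFin \o g) -> (forall x, D x -> `|f x| <= g x) ->
  mu.-integrable D (EFin \o f).
Proof.
move=> mD mf Ig fg; refine (@le_integrable _ _ _ mu _ mD _ _ _ _ Ig) => /=.
  exact/measurable_EFinP.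
by move=> x Dx; rewrite lee_fin (le_trans (fg x Dx))// ler_norm.
Qed.

Lemma integrableS_EFin D D' f : measurable D -> measurable D' -> D `<=` D' ->
  mu.-integrable D' (EFin \o f) -> mu.-integrable D (EFin \o f).
Proof. by move=> mD mD' DD' If; refine (@integrableS _ _ _ mu _ _ _ mD' mD DD' If). Qed.

Lemma L2onM D f g : measurable D -> L2on D f -> L2on D g ->
  mu.-integrable D (EFin \o (fun x => f x * g x)).
Proof.
move=> mD [mf If] [mg Ig].
apply: (integrable_le_EFin mD _ (integrableD_EFin mD If Ig)).
  exact: measurable_funM.
by move=> x _; rewrite ler_norml; apply/andP; split; nra.
Qed.

Lemma L2on_le D f g : measurable D -> measurable_fun D f -> L2on D g ->
  (forall x, D x -> `|f x| <= `|g x|) -> L2on D f.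
Proof.
move=> mD mf [mg Ig] fg; split=> //.
apply: (integrable_le_EFin mD _ Ig); first exact: measurable_funX.
by move=> x Dx; rewrite normrX -(@real_normK _ (g x)) ?num_real// ler_sqr ?nnegrE// fg.
Qed.

Lemma L2onZ D k f : measurable D -> L2on D f -> L2on D (fun x => k * f x).
Proof.
move=> mD [mf If]; split; first exact: measurable_funM.
apply: (integrable_le_EFin mD _ (integrableZ_EFin (k ^+ 2) mD If)).
  by apply: measurable_funX; exact: measurable_funM.
by move=> x _; rewrite exprMn ger0_norm// mulr_ge0// sqr_ge0.
Qed.

Lemma L2onD D f g : measurable D -> L2on D f -> L2on D g ->
  L2on D (fun x => f x + g x).
Proof.
move=> mD [mf If] [mg Ig]; split; first exact: measurable_funD.
apply: (integrable_le_EFin mD _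
  (integrableZ_EFin 2 mD (integrableD_EFin mD If Ig))).
  by apply: measurable_funX; exact: measurable_funD.
by move=> x _; rewrite ger0_norm ?sqr_ge0//; have := sqr_ge0 (f x - g x); nra.
Qed.

Lemma L2onN D f : measurable D -> L2on D f -> L2on D (fun x => - f x).
Proof. by move=> mD /(L2onZ (-1) mD); under eq_fun do rewrite mulN1r. Qed.

Lemma L2onB D f g : measurable D -> L2on D f -> L2on D g ->
  L2on D (fun x => f x - g x).
Proof. by move=> mD hf /(L2onN mD); exact: L2onD. Qed.

Lemma L2onS D D' f : measurable D -> measurable D' -> D `<=` D' ->
  L2on D' f -> L2on D f.
Proof.
move=> mD mD' DD' [mf If]; split; first exact: measurable_funS mf.
exact: integrableS_EFin If.
Qed.

Lemma L2on_Lloc1 f : L2on setT f -> Lloc1 f.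
Proof.
move=> [mf If]; split => // a b.
have Jf : mu.-integrable `[a, b] (EFin \o (fun x => f x ^+ 2)).
  by apply: integrableS_EFin If.
apply: (integrable_le_EFin _ _ (integrableD_EFin _ (Lloc1_itv a b (Lloc1_cst 1)) Jf)) => //.
  exact: measurable_funTS.
by move=> x _; rewrite ler_norml; apply/andP; split; nra.
Qed.

Lemma L2on_itv_continuous f a b : continuous f -> L2on `[a, b] f.
Proof.
move=> cf; split.
  by apply: measurable_funTS; exact: continuous_measurable_fun.
by apply: Lloc1_itv; apply: Lloc1_continuous => x; apply: cvgM; exact: cf.
Qed.

Lemma L2on_indic D f : measurable D -> L2on D f -> L2on setT (fun x => \1_D x * f x).
Proof.
move=> mD [mf If].
have E : (fun x => \1_D x * f x) = f \_ D.
  by apply/funext => x; rewrite patchE indicE; case: (_ \in _); rewrite ?mul1r// mul0r.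
rewrite E; split; first exact/(measurable_restrictT _ mD).
have -> : EFin \o (fun x => (f \_ D) x ^+ 2) = (EFin \o (fun x => f x ^+ 2)) \_ D.
  by apply/funext => x; rewrite /= !patchE; case: ifP => // _; rewrite expr0n.
exact: (@integrable_mkcond _ _ _ mu _ _ mD).1.
Qed.

Lemma Rintegral_indic D f : measurable D ->
  \int[mu]_x (\1_D x * f x) = \int[mu]_(x in D) f x.
Proof.
move=> mD; rewrite [RHS]Rintegral_mkcond; apply: eq_Rintegral => x _.
by rewrite patchE indicE; case: (_ \in _); rewrite ?mul1r// mul0r.
Qed.

Lemma integrable_indic_EFin D f : measurable D -> mu.-integrable D (EFin \o f) ->
  mu.-integrable setT (EFin \o (fun x => \1_D x * f x)).
Proof.
move=> mD If.
have -> : EFin \o (fun x => \1_D x * f x) = (EFin \o f) \_ D.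
  apply/funext => x; rewrite /= patchE indicE.
  by case: (_ \in _); rewrite ?mul1r// mul0r.
exact: (@integrable_mkcond _ _ _ mu _ _ mD).1.
Qed.

Lemma Rintegral_cvg_itv f : mu.-integrable setT (EFin \o f) ->
  \int[mu]_(x in `[- n%:R, n%:R]) f x @[n --> \oo] --> \int[mu]_x f x.
Proof.
move=> If; have mf : measurable_fun setT f.
  by have /integrableP[/measurable_EFinP] := If.
have := @dominated_convergence _ _ _ mu setT _
  (fun n x => (\1_(`[- n%:R, n%:R]%classic : set R) x * f x)%:E) (EFin \o f)
  (fun x => `|f x|%:E).
case=> //.
- by move=> n; apply/measurable_EFinP; apply: measurable_funM => //.
- exact/measurable_EFinP.
- apply: aeW => x _; apply: cvg_near_cst; near=> n.
  rewrite indicE mem_set ?mul1r//= in_itv/= -ler_norml.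
  by near: n; exact: nbhs_infty_ger.
- exact: integrable_norm.
- apply: aeW => x n _; rewrite lee_fin normrM indicE.
  by case: (_ \in _); rewrite ?normr1 ?mul1r// normr0 mul0r.
move=> _ _.
rewrite -[in X in _ --> X -> _](@fineK _ (\int[mu]_x (f x)%:E)); last first.
  by apply: (integrable_fin_num _ If).
move=> /fine_cvgP[_]; apply: cvg_trans; apply: near_eq_cvg; apply: nearW => n /=.
by rewrite -Rintegral_indic.
Unshelve. all: by end_near. Qed.

Lemma Rintegral_itv0 f a b : Lloc1 f -> (forall x, a < x < b -> f x = 0) ->
  \int[mu]_(x in `[a, b]) f x = 0.
Proof.
move=> If f0; rewrite /Rintegral integral_itv_bndoo; last first.
  by apply/measurable_EFinP; apply: measurable_funTS; case: If.
by rewrite integral0_eq// => x /=; rewrite in_itv/= => /f0 ->.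
Qed.

(** A nonzero value would persist on a ball, which has positive measure and cannot lie in a null
    set. *)
Lemma continuous_ae0 h a b : continuous h ->
  {ae mu, forall x, a < x < b -> h x = 0} -> forall x, a < x < b -> h x = 0.
Proof.
move=> ch [N [mN N0 hN]] x /andP[ax xb]; apply/eqP; apply/negPn/negP => hx.
have : \forall y \near x, a < y < b /\ h y != 0.
  near=> y; split.
    by apply/andP; split; near: y; [exact: lt_nbhsr|exact: lt_nbhsl].
  by near: y; apply: (cvgr_neq0 _ (ch x)).
move=> [e /= e0 He].
have : (mu (ball x e) <= mu N)%E.
  apply: le_measure; rewrite ?inE//; first exact: measurable_ball.
  by move=> y /He [yab /eqP hy]; apply: hN => /(_ yab).
have muB : mu (ball x e) = (e *+ 2)%:E by exact: (lebesgue_measure_ball _ (ltW e0)).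
by rewrite [X in (X <= _)%E]muB [X in (_ <= X)%E]N0 lee_fin leNgt mulrn_wgt0.
Unshelve. all: by end_near. Qed.

Lemma L2_cauchy_schwarz f g : L2on setT f -> L2on setT g ->
  (\int[mu]_x (f x * g x)) ^+ 2 <=
    (\int[mu]_x (f x ^+ 2)) * (\int[mu]_x (g x ^+ 2)).
Proof.
move=> hf hg; have [[mf If] [mg Ig]] := (hf, hg).
have Ifg := L2onM measurableT hf hg.
set A := \int[mu]_x (f x ^+ 2); set B := \int[mu]_x (g x ^+ 2).
set S := \int[mu]_x (f x * g x).
(* The form is the integral of (s f - t g)^2. At (B, S) it equals B (A B - S^2), which settles B >
   0; if B = 0 and S is nonzero, the point (1, (A + 1) / S) gives the negative value - A - 2. *)
have H s t : 0 <= s ^+ 2 * A - 2 * s * t * S + t ^+ 2 * B.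
  have : 0 <= \int[mu]_x ((s * f x - t * g x) ^+ 2).
    by apply: Rintegral_ge0 => x _; exact: sqr_ge0.
  rewrite (_ : \int[mu]_x _ = \int[mu]_x (s ^+ 2 * f x ^+ 2
      - (2 * s * t) * (f x * g x) + t ^+ 2 * g x ^+ 2)); last first.
    by apply: eq_Rintegral => x _; ring.
  have J1 := integrableZ_EFin (s ^+ 2) measurableT If.
  have J2 := integrableZ_EFin (2 * s * t) measurableT Ifg.
  have J3 := integrableZ_EFin (t ^+ 2) measurableT Ig.
  rewrite RintegralD//; last exact: integrableB_EFin.
  by rewrite RintegralB// !RintegralZl.
have A0 : 0 <= A by apply: Rintegral_ge0 => x _; exact: sqr_ge0.
have B0 : 0 <= B by apply: Rintegral_ge0 => x _; exact: sqr_ge0.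
have [B0'|Bn0] := eqVneq B 0.
  rewrite B0' mulr0; have [->|Sn0] := eqVneq S 0; first by rewrite expr0n.
  have := H 1 ((A + 1) / S); rewrite B0' mulr0 addr0 expr1n mul1r mulr1.
  by rewrite -!mulrA mulVf// mulr1 => h; exfalso; lra.
have Bp : 0 < B by rewrite lt_def Bn0.
have h := H B S; rewrite -subr_ge0 -(pmulr_rge0 _ Bp).
by move: h; congr (_ <= _); ring.
Qed.

End SquareIntegrable.

(** * The quasi-differential system *)

Section QuasiSystem.
Variable R : realType.
Local Notation mu := (@lebesgue_measure R).
Variables (P al be : R -> R).
Implicit Types (f g h u v : R -> R) (a b x m M : R).

(* [l[u] = f] as a first order system, [u1] being the quasi-derivative of [u];
   it is used with P = 1 / p, al = Q / p and be = (Q^2 + r^2) / p - s, the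
   r-terms of the quasi-derivatives having been removed by the gauge below. *)
Definition qsol f u u1 :=
  ACloc u (fun x => P x * u1 x + al x * u x) /\
  ACloc u1 (fun x => - f x - al x * u1 x - be x * u x).

Lemma qsol_lin k l f u u1 g v v1 : qsol f u u1 -> qsol g v v1 ->
  qsol (fun x => k * f x + l * g x) (fun x => k * u x + l * v x)
       (fun x => k * u1 x + l * v1 x).
Proof.
move=> [Hu Hu1] [Hv Hv1]; split.
  by apply: ACloc_eq (AClocD (AClocZ k Hu) (AClocZ l Hv)) => x //; ring.
by apply: ACloc_eq (AClocD (AClocZ k Hu1) (AClocZ l Hv1)) => x //; ring.
Qed.

Lemma qsol_continuous f u u1 : qsol f u u1 -> continuous u /\ continuous u1.
Proof. by move=> [Hu Hu1]; split; [exact: ACloc_continuous Hu|exact: ACloc_continuous Hu1]. Qed.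

(** Lagrange identity: the terms in [P], [al] and [be] cancel because the expression is formally
    symmetric. *)
Lemma qsol_cross f u u1 g v v1 : qsol f u u1 -> qsol g v v1 ->
  ACloc (fun x => u1 x * v x - u x * v1 x) (fun x => u x * g x - f x * v x).
Proof.
move=> [Hu Hu1] [Hv Hv1].
by apply: ACloc_eq (AClocB (AClocM Hu1 Hv) (AClocM Hu Hv1)) => x //; ring.
Qed.

(** Where u vanishes so does its derivative, hence P u1 = 0 almost everywhere; continuity of u1
    removes the exceptional set. This transfers compact support from u to its quasi-derivative. *)
Lemma qsol_zero f u u1 a b : {ae mu, forall x, P x != 0} -> qsol f u u1 ->
  (forall x, a < x < b -> u x = 0) -> forall x, a < x < b -> u1 x = 0.
Proof.
move=> P0 hu u0; have [_ cu1] := qsol_continuous hu.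
apply: continuous_ae0 => //.
apply: ae_imp (ae_conj P0 (ACloc_zero_ae hu.1 u0)) => x [Px E] xab.
by have /eqP := E xab; rewrite u0// mulr0 addr0 mulf_eq0 (negbTE Px) => /eqP.
Qed.

(** The Lagrange bracket vanishes outside [-M, M] together with u and u1, so no boundary term
    survives, whatever the growth of v and v1. *)
Lemma qsol_green f u (u1 : R -> R) g v (v1 : R -> R) M : {ae mu, forall x, P x != 0} ->
  qsol f u u1 -> qsol g v v1 -> (forall x, M < `|x| -> u x = 0) ->
  mu.-integrable setT (EFin \o (fun x => f x * v x)) ->
  mu.-integrable setT (EFin \o (fun x => u x * g x)) ->
  \int[mu]_x (f x * v x) = \int[mu]_x (u x * g x).
Proof.
move=> P0 hu hv u0 I1 I2.
have AW := qsol_cross hu hv.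
have u10 x : M < `|x| -> u1 x = 0.
  rewrite ltr_normr => /orP[Mx|Mx].
    apply: (qsol_zero (a := M) (b := x + 1) P0 hu); last by rewrite Mx ltrDl ltr01.
    by move=> t /andP[Mt _]; apply: u0; rewrite ltr_normr Mt.
  apply: (qsol_zero (a := x - 1) (b := - M) P0 hu).
    by move=> t /andP[_ Mt]; apply: u0; rewrite ltr_normr ltrNr Mt orbT.
  by rewrite ltrBlDr ltrDl ltr01/= ltrNr.
apply/eqP; rewrite -subr_eq0 -oppr_eq0 opprB -RintegralB//.
have := Rintegral_cvg_itv (integrableB_EFin measurableT I2 I1).
move=> H; apply/eqP; apply: (cvg_unique _ H) => //.
apply: cvg_near_cst; near=> n.
have Mn : M < n%:R by near: n; exact: nbhs_infty_gtr.
have n0 : 0 <= n%:R :> R by [].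
rewrite (ACloc_Rintegral AW); last by apply: le_trans n0; rewrite oppr_le0.
rewrite !u0 ?u10 ?normrN ?ger0_norm// ; lra.
Unshelve. all: by end_near. Qed.

Hypothesis IP : Lloc1 P.
Hypothesis Ial : Lloc1 al.
Hypothesis Ibe : Lloc1 be.

Lemma qsol_fundamental : exists y1 Y1 y2 Y2 : R -> R,
  [/\ qsol (fun=> 0) y1 Y1, qsol (fun=> 0) y2 Y2,
      y1 0 = 1 /\ Y1 0 = 0, y2 0 = 0 /\ Y2 0 = 1 &
      forall x, y1 x * Y2 x - Y1 x * y2 x = 1].
Proof.
(* The index [true] stands for the function and [false] for its quasi-derivative. *)
pose A i j : R -> R := match i, j with
  | true, true => al | true, false => P
  | false, true => fun x => - be x | false, false => fun x => - al x end.
have IA i j : Lloc1 (A i j) by case: i; case: j => //=; exact: Lloc1N.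
have S (c : bool -> R) : exists y Y, [/\ qsol (fun=> 0) y Y, y 0 = c true & Y 0 = c false].
  have [w [w0 hw]] := linear_system_solution c IA.
  exists (w true), (w false); split; [split| |]; rewrite ?w0//.
    by apply: ACloc_eq (hw true) => x //=; rewrite addrC.
  by apply: ACloc_eq (hw false) => x //=; ring.
have [y1 [Y1 [h1 y10 Y10]]] := S (fun c : bool => c%:R).
have [y2 [Y2 [h2 y20 Y20]]] := S (fun c : bool => (~~ c)%:R).
exists y1, Y1, y2, Y2; split => // x.
have W := qsol_cross h1 h2.
have /ACloc0_const H : ACloc (fun x => Y1 x * y2 x - y1 x * Y2 x) (fun=> 0).
  by apply: ACloc_eq W => t //; rewrite mulr0 mul0r subrr.
have := H x 0; rewrite y10 Y10 y20 Y20/= mul0r mulr1 => E.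
by apply/eqP; rewrite -subr_eq0 -oppr_eq0; apply/eqP; move: E => /eqP; rewrite -subr_eq0 => /eqP <-; ring.
Qed.

(** Variation of constants. The derivatives of H1 and H2 cancel in the first equation and contribute
    - f times the Wronskian in the second. *)
Lemma qsol_variation (y1 Y1 y2 Y2 : R -> R) f (H1 H2 : R -> R) :
  qsol (fun=> 0) y1 Y1 -> qsol (fun=> 0) y2 Y2 ->
  (forall x, y1 x * Y2 x - Y1 x * y2 x = 1) ->
  ACloc H1 (fun x => y1 x * f x) -> ACloc H2 (fun x => y2 x * f x) ->
  qsol f (fun x => y1 x * H2 x - y2 x * H1 x) (fun x => Y1 x * H2 x - Y2 x * H1 x).
Proof.
move=> [h1 k1] [h2 k2] W A1 A2; split.
  by apply: ACloc_eq (AClocB (AClocM h1 A2) (AClocM h2 A1)) => x //; ring.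
apply: ACloc_eq (AClocB (AClocM k1 A2) (AClocM k2 A1)) => x //.
rewrite -[in RHS](mulr1 (f x)) -(W x); ring.
Qed.

Lemma qsol_exists f : Lloc1 f -> exists u u1, qsol f u u1.
Proof.
move=> If; have [y1 [Y1 [y2 [Y2 [h1 h2 _ _ W]]]]] := qsol_fundamental.
have [[c1 _] [c2 _]] := (qsol_continuous h1, qsol_continuous h2).
by do 2 eexists; apply: (qsol_variation h1 h2 W); apply: ACloc_prim; exact: Lloc1M.
Qed.

(** In the variation of constants formula the primitives of y1 f and y2 f are started at - m. They
    vanish to the left because f does, and to the right because of the two moment conditions. *)
Lemma qsol_range (y1 Y1 y2 Y2 : R -> R) f m :
  qsol (fun=> 0) y1 Y1 -> qsol (fun=> 0) y2 Y2 ->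
  (forall x, y1 x * Y2 x - Y1 x * y2 x = 1) ->
  Lloc1 f -> 0 <= m -> (forall x, m < `|x| -> f x = 0) ->
  \int[mu]_(x in `[- m, m]) (y1 x * f x) = 0 ->
  \int[mu]_(x in `[- m, m]) (y2 x * f x) = 0 ->
  exists u u1, qsol f u u1 /\ forall x, m < `|x| -> u x = 0.
Proof.
move=> h1 h2 W If m0 f0 o1 o2.
have [[c1 _] [c2 _]] := (qsol_continuous h1, qsol_continuous h2).
have I1 : Lloc1 (fun x => y1 x * f x) by exact: Lloc1M.
have I2 : Lloc1 (fun x => y2 x * f x) by exact: Lloc1M.
have S (y : R -> R) : continuous y -> \int[mu]_(x in `[- m, m]) (y x * f x) = 0 ->
    exists H, ACloc H (fun x => y x * f x) /\ forall x, m < `|x| -> H x = 0.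
  move=> cy o; have I : Lloc1 (fun x => y x * f x) by exact: Lloc1M.
  have A := ACloc_prim I; set F := prim _ in A.
  exists (fun x => F x - F (- m)); split.
    by apply: ACloc_eq (AClocB A (ACloc_cst (F (- m)))) => x //; rewrite subr0.
  move=> x; rewrite ltr_normr => /orP[Mx|Mx].
    rewrite -(ACloc_Rintegral A); last by lra.
    rewrite (@Rintegral_itvD _ _ (- m) m x)//; [|lra|lra].
    rewrite o add0r Rintegral_itv0// => t /andP[mt _].
    by rewrite f0 ?mulr0// ltr_normr mt.
  apply/eqP; rewrite -oppr_eq0 opprB -(ACloc_Rintegral A); last by lra.
  rewrite Rintegral_itv0// => t /andP[_ mt].
  by rewrite f0 ?mulr0// ltr_normr ltrNr mt orbT.
have [H1 [A1 Z1]] := S y1 c1 o1; have [H2 [A2 Z2]] := S y2 c2 o2.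
exists (fun x => y1 x * H2 x - y2 x * H1 x), (fun x => Y1 x * H2 x - Y2 x * H1 x).
split; first exact: qsol_variation.
by move=> x mx; rewrite Z1// Z2// !mulr0 subrr.
Qed.

End QuasiSystem.

(** * Integrals of compactly supported functions and exhaustion by intervals *)

Section Compact.
Variable R : realType.
Local Notation mu := (@lebesgue_measure R).
Implicit Types (f g h : R -> R) (D : set R) (a b x m M : R).

Lemma ACloc_integral0 W g M : ACloc W g -> mu.-integrable setT (EFin \o g) ->
  (forall x, M < `|x| -> W x = 0) -> \int[mu]_x g x = 0.
Proof.
move=> AW Ig W0; have H := Rintegral_cvg_itv Ig.
apply: (cvg_unique _ H) => //; apply: cvg_near_cst; near=> n.
have Mn : M < n%:R by near: n; exact: nbhs_infty_gtr.
have n0 : 0 <= n%:R :> R by [].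
rewrite (ACloc_Rintegral AW); last by apply: le_trans n0; rewrite oppr_le0.
by rewrite !W0 ?subrr// ?normrN ger0_norm.
Unshelve. all: by end_near. Qed.

Lemma Rintegral_sqr_eq0 D f : measurable D -> L2on D f ->
  \int[mu]_(x in D) (f x ^+ 2) = 0 -> {ae mu, forall x, D x -> f x = 0}.
Proof.
move=> mD [mf If] f0.
have E : (\int[mu]_(x in D) `|(f x ^+ 2)%:E| = 0)%E.
  under eq_integral do rewrite gee0_abs ?lee_fin ?sqr_ge0//.
  rewrite -[LHS]fineK; first by rewrite -/(Rintegral _ _ _) f0.
  by apply: (integrable_fin_num _ If).
have := (ae_eq_integral_abs mu mD (measurable_int mu If)).1 E.
by apply: ae_imp => x H /H; move=> /= [] /eqP; rewrite sqrf_eq0 => /eqP.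
Qed.

Lemma L2on_compact f M : continuous f -> (forall x, M < `|x| -> f x = 0) -> L2on setT f.
Proof.
move=> cf f0; have := L2on_indic (measurable_itv _) (L2on_itv_continuous (- M) M cf).
rewrite (_ : (fun x => _) = f)//; apply/funext => x; rewrite indicE.
have [xM|xM] := boolP (x \in _); first by rewrite mul1r.
rewrite mul0r f0// ltNge ler_norml; apply/negP => xMM; move/negP: xM; apply.
by rewrite inE/= in_itv.
Qed.

Lemma L2onM_compact f g M : measurable_fun setT f -> L2on setT g -> continuous f ->
  (forall x, M < `|x| -> g x = 0) -> L2on setT (fun x => g x * f x).
Proof.
move=> mf hg cf g0; have [B HB] := continuous_bounded_itv (- M) M cf.
apply: (@L2on_le _ setT _ (fun x => B * g x)) => //.
- by apply: measurable_funM => //; case: hg.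
- exact: L2onZ.
move=> x _; have [xM|xM] := leP `|x| M; last by rewrite g0// mulr0 mul0r.
rewrite !normrM mulrC ler_wpM2r//; rewrite ler_norml in xM.
exact: (le_trans (HB x xM) (ler_norm _)).
Qed.

Lemma L2on_bounded f (K : R) : continuous f ->
  (\forall n \near \oo, \int[mu]_(x in `[- n%:R, n%:R]) (f x ^+ 2) <= K) ->
  L2on setT f.
Proof.
move=> cf fK; have mf := continuous_measurable_fun cf.
split => //; have mf2 : measurable_fun setT (EFin \o (fun x => f x ^+ 2)).
  by apply/measurable_EFinP; exact: measurable_funX.
apply/integrableP; split => //.
under eq_integral do rewrite gee0_abs ?lee_fin ?sqr_ge0//.
pose F (n : nat) := `[- n%:R, n%:R]%classic : set R.
have FT : \bigcup_n F n = setT.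
  apply/seteqP; split => // x _; exists (Num.bound `|x|) => //.
  by rewrite /F/= in_itv/= -ler_norml; apply: ltW; exact: archi_boundP.
rewrite -FT; have H := @ge0_nondecreasing_set_cvg_integral _ (measurableTypeR R) _ F
  (EFin \o (fun x => f x ^+ 2)) mu.
apply: (@le_lt_trans _ _ K%:E); last by rewrite ltry.
have {}H : (\int[mu]_(x in F i) (f x ^+ 2)%:E @[i --> \oo] -->
    \int[mu]_(x in \bigcup_i F i) (f x ^+ 2)%:E)%E.
  apply: H.
  - move=> i j ij; apply/subsetPset => x; rewrite /F/= !in_itv/= => /andP[xi ix].
    have : i%:R <= j%:R :> R by rewrite ler_nat.
    by move=> ij'; apply/andP; split; lra.
  - by move=> i; exact: measurable_itv.
  - by move=> i; apply: measurable_funTS.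
  - by move=> i x _; rewrite lee_fin sqr_ge0.
apply: (cvge_to_le H); apply: filterS fK => n fn.
rewrite -[leLHS]fineK; first by rewrite lee_fin.
have I : Lloc1 (fun x => f x ^+ 2).
  by apply: Lloc1_continuous => x; apply: cvgM; exact: cf.
by apply: (integrable_fin_num _ (Lloc1_itv _ _ I)).
Qed.

End Compact.

(** * Regularity of functions satisfying the adjoint relation *)

Section Adjoint.
Variable R : realType.
Local Notation mu := (@lebesgue_measure R).
Variables (P al be : R -> R).
Hypothesis P0 : {ae mu, forall x, P x != 0}.
Hypothesis IP : Lloc1 P.
Hypothesis Ial : Lloc1 al.
Hypothesis Ibe : Lloc1 be.
Local Notation sol := (qsol P al be).
Implicit Types (f g h u v w z d e : R -> R) (x m M t : R) (n : nat).

Lemma qsol_itv_ae0 u u1 m : sol (fun=> 0) u u1 -> 0 < m ->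
  {ae mu, forall x, - m < x < m -> u x = 0} -> u 0 = 0 /\ u1 0 = 0.
Proof.
move=> hu m0 u0; have [cu cu1] := qsol_continuous hu.
have Z := continuous_ae0 cu u0.
have m00 : - m < 0 < m by rewrite oppr_lt0 m0.
by split; [exact: Z|exact: (qsol_zero P0 hu Z)].
Qed.

Variables (y1 Y1 y2 Y2 : R -> R).
Hypothesis h1 : sol (fun=> 0) y1 Y1.
Hypothesis h2 : sol (fun=> 0) y2 Y2.
Hypothesis i1 : y1 0 = 1 /\ Y1 0 = 0.
Hypothesis i2 : y2 0 = 0 /\ Y2 0 = 1.
Hypothesis wronskian : forall x, y1 x * Y2 x - Y1 x * y2 x = 1.

Local Notation comb k l := (fun x => k * y1 x + l * y2 x).

Lemma comb_sol k l : sol (fun=> 0) (comb k l) (fun x => k * Y1 x + l * Y2 x).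
Proof.
have [A B] := qsol_lin k l h1 h2; split => //.
by apply: ACloc_eq B => x //; rewrite !mulr0 addr0.
Qed.

Lemma comb_continuous k l : continuous (comb k l).
Proof. exact: (qsol_continuous (comb_sol k l)).1. Qed.

Lemma comb_ae0 k l m : 0 < m -> {ae mu, forall x, - m < x < m -> comb k l x = 0} ->
  k = 0 /\ l = 0.
Proof.
move=> m0 /(qsol_itv_ae0 (comb_sol k l) m0).
by rewrite i1.1 i1.2 i2.1 i2.2 !mulr1 !mulr0 addr0 add0r.
Qed.

(** A combination with zero integral vanishes around 0 and so has zero Cauchy data there. Thus the
    Gram matrix of [y1] and [y2] is positive definite on every [-m, m]. *)
Lemma comb_sqr_gt0 k l m : 0 < m -> (k != 0) || (l != 0) ->
  0 < \int[mu]_(x in `[- m, m]) (comb k l x ^+ 2).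
Proof.
move=> m0 kl; rewrite lt_def; apply/andP; split; last first.
  by apply: Rintegral_ge0 => x _; exact: sqr_ge0.
apply/negP => /eqP /Rintegral_sqr_eq0 -/(_ (measurable_itv _)).
move=> /(_ (L2on_itv_continuous _ _ (@comb_continuous k l))) H.
have [] := @comb_ae0 k l m m0.
  by apply: ae_imp H => x H /andP[x1 x2]; apply: H; rewrite /= in_itv/= !ltW.
by move=> k0 l0; rewrite k0 l0 eqxx in kl.
Qed.

Definition ipm m f g := \int[mu]_(x in `[- m, m]) (f x * g x).

Lemma ipmC m f g : ipm m f g = ipm m g f.
Proof. by apply: eq_Rintegral => x _; rewrite mulrC. Qed.

Lemma ipm_lin m f g h k l : L2on `[- m, m] f -> L2on `[- m, m] g ->
  L2on `[- m, m] h -> ipm m f (fun x => k * g x + l * h x) = k * ipm m f g + l * ipm m f h.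
Proof.
move=> hf hg hh; have mD : measurable `[- m, m]%classic by exact: measurable_itv.
have I1 := L2onM mD hf hg; have I2 := L2onM mD hf hh.
rewrite /ipm -!RintegralZl// -RintegralD//; try exact: integrableZ_EFin.
by apply: eq_Rintegral => x _; ring.
Qed.

Lemma ipm_projection m z : 0 < m -> L2on `[- m, m] z -> exists k l,
  let h := (fun x => z x - comb k l x) in ipm m y1 h = 0 /\ ipm m y2 h = 0.
Proof.
move=> m0 hz.
have H k l : L2on `[- m, m] (comb k l) by apply: L2on_itv_continuous; exact: comb_continuous.
have [c1 c2] := (qsol_continuous h1, qsol_continuous h2).
have [L1 L2] : L2on `[- m, m] y1 /\ L2on `[- m, m] y2.
  by split; apply: L2on_itv_continuous; [exact: c1.1|exact: c2.1].
set A := ipm m y1 y1; set B := ipm m y1 y2; set C := ipm m y2 y2.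
have Q k l : (k != 0) || (l != 0) -> 0 < k ^+ 2 * A + 2 * k * l * B + l ^+ 2 * C.
  move=> kl; have := comb_sqr_gt0 m0 kl.
  rewrite (_ : \int[mu]_(x in _) _ = ipm m (comb k l) (comb k l)); last first.
    by apply: eq_Rintegral => x _; rewrite expr2.
  rewrite ipm_lin// ![ipm m (comb k l) _]ipmC !ipm_lin//.
  by rewrite -/A -/B -/C [ipm m y2 y1]ipmC -/B; congr (_ < _); ring.
have C0 : 0 < C.
  by have := Q 0 1; rewrite oner_eq0 orbT expr0n !mul0r mulr0 !mul0r !add0r expr1n mul1r => ->.
(* At (C, - B) the Gram form equals C (A C - B^2). *)
have det0 : 0 < A * C - B ^+ 2.
  have := Q C (- B); rewrite gt_eqF// => /(_ isT).
  rewrite (_ : _ + _ = C * (A * C - B ^+ 2)); last by ring.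
  by rewrite pmulr_rgt0.
have dn0 : A * C - B ^+ 2 != 0 by rewrite gt_eqF.
set b1 := ipm m y1 z; set b2 := ipm m y2 z.
(* Cramer's rule for the normal equations k A + l B = b1 and k B + l C = b2. *)
pose k := (C * b1 - B * b2) / (A * C - B ^+ 2).
pose l := (A * b2 - B * b1) / (A * C - B ^+ 2).
exists k, l.
have S f : L2on `[- m, m] f -> ipm m f (fun x => z x - comb k l x) =
    ipm m f z - (k * ipm m f y1 + l * ipm m f y2).
  move=> hf; rewrite -ipm_lin//.
  rewrite -[X in X - _]mul1r -[X in _ - X]mul1r -mulNr -ipm_lin//.
  by apply: eq_Rintegral => x _; ring.
rewrite /= !S// -/A -/B -/C -/b1 -/b2 [ipm m y2 y1]ipmC -/B /k /l.
by split; field.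
Qed.

(** Let r be v - v0 minus its projection on the solution space over [-m, m]. Cut off to the
    interval, r satisfies both moment conditions, so it is l[u] for some u of compact support. The
    hypothesis and Green's formula for v0 show that r is orthogonal to v - v0, hence to itself. *)
Lemma adjoint_itv v w v0 v01 m : 0 < m -> L2on setT v -> L2on setT w ->
  sol w v0 v01 ->
  (forall f u u1, sol f u u1 -> (exists M, forall x, M < `|x| -> u x = 0) ->
    L2on setT f -> \int[mu]_x (f x * v x) = \int[mu]_x (u x * w x)) ->
  exists k l, {ae mu, forall x, - m <= x <= m -> v x = v0 x + comb k l x}.
Proof.
move=> m0 hv hw hv0 H.
have mD : measurable `[- m, m]%classic by exact: measurable_itv.
pose z x := v x - v0 x.
have L0 : L2on `[- m, m] v0.
  by apply: L2on_itv_continuous; exact: (qsol_continuous hv0).1.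
have hz : L2on `[- m, m] z by apply: L2onB => //; exact: L2onS hv.
have [k [l [/= o1 o2]]] := ipm_projection m0 hz.
exists k, l; set D := `[- m, m]%classic in mD.
pose r x := z x - comb k l x.
have hr : L2on D r.
  by apply: L2onB => //; apply: L2on_itv_continuous; exact: comb_continuous.
pose h x := \1_D x * r x.
have hh : L2on setT h by exact: L2on_indic.
have h_off x : m < `|x| -> h x = 0.
  move=> mx; rewrite /h indicE memNset ?mul0r//= /D/= in_itv/= -ler_norml.
  by rewrite leNgt mx.
have on y : \int[mu]_(x in D) (y x * h x) = ipm m y r.
  by apply: eq_Rintegral => x xD; rewrite /h indicE xD mul1r.
have [u [u1 [hu u0]]] : exists u u1, sol h u u1 /\ forall x, m < `|x| -> u x = 0.
  apply: (qsol_range h1 h2 wronskian) => //; [exact: L2on_Lloc1|exact: ltW| |].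
  - by rewrite on.
  - by rewrite on.
have hu2 : L2on setT u by exact: L2on_compact (qsol_continuous hu).1 u0.
have E1 := H h u u1 hu (ex_intro _ m u0) hh.
have Ihv0 : mu.-integrable setT (EFin \o (fun x => h x * v0 x)).
  rewrite (_ : (fun x => _) = (fun x => \1_D x * (r x * v0 x))); last first.
    by apply/funext => x; rewrite /h mulrA.
  by apply: integrable_indic_EFin => //; exact: L2onM.
have E2 := qsol_green P0 hu hv0 u0 Ihv0 (L2onM measurableT hu2 hw).
have Z : ipm m r z = 0.
  have -> : ipm m r z = \int[mu]_x (h x * v x - h x * v0 x).
    rewrite /ipm -Rintegral_indic//; apply: eq_Rintegral => x _.
    by rewrite /h /z; ring.
  rewrite RintegralB//; last exact: L2onM.
  by rewrite E1 E2 subrr.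
have rr : \int[mu]_(x in D) (r x ^+ 2) = 0.
  have -> : \int[mu]_(x in D) (r x ^+ 2) = ipm m r (fun x => 1 * z x + (-1) * comb k l x).
    by apply: eq_Rintegral => x _; rewrite expr2 {2}/r; ring.
  rewrite ipm_lin//; last by apply: L2on_itv_continuous; exact: comb_continuous.
  rewrite Z ipm_lin//; try by apply: L2on_itv_continuous; first [exact: (qsol_continuous h1).1|exact: (qsol_continuous h2).1].
  by rewrite ![ipm m r _]ipmC o1 o2; ring.
move: (Rintegral_sqr_eq0 mD hr rr); apply: ae_imp => x H' xm.
have : D x by rewrite /D/= in_itv.
by move=> /H'; rewrite /r /z => /eqP; rewrite subr_eq0 subr_eq => /eqP ->; rewrite addrC.
Qed.

(** The coefficients obtained on [-1, 1] serve on every larger interval: the difference of two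
    representations is a solution vanishing almost everywhere on (-1, 1), hence trivial. The
    intervals are indexed by [n.+1] so that each contains [-1, 1]. *)
Lemma qsol_adjoint v w : L2on setT v -> L2on setT w ->
  (forall f u u1, sol f u u1 -> (exists M, forall x, M < `|x| -> u x = 0) ->
    L2on setT f -> \int[mu]_x (f x * v x) = \int[mu]_x (u x * w x)) ->
  exists v' v1, sol w v' v1 /\ {ae mu, forall x, v x = v' x}.
Proof.
move=> hv hw H; have [v0 [v01 hv0]] := qsol_exists IP Ial Ibe (L2on_Lloc1 hw).
have [k [l kl]] := adjoint_itv ltr01 hv hw hv0 H.
exists (fun x => 1 * v0 x + 1 * comb k l x),
  (fun x => 1 * v01 x + 1 * (k * Y1 x + l * Y2 x)); split.
  have [A B] := qsol_lin 1 1 hv0 (comb_sol k l); split => //.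
  by apply: ACloc_eq B => x //; rewrite mulr0 addr0 mul1r.
suff S n : {ae mu, forall x, - n.+1%:R <= x <= n.+1%:R -> v x = v0 x + comb k l x}.
  have := ae_foralln S; apply: ae_imp => x Hx.
  rewrite !mul1r; apply: (Hx (Num.bound `|x|)).
  rewrite -ler_norml; apply: (le_trans (ltW (archi_boundP (normr_ge0 x)))).
  by rewrite ler_nat.
have n0 : 0 < n.+1%:R :> R by [].
have [k' [l' kl']] := adjoint_itv n0 hv hw hv0 H.
have [] := @comb_ae0 (k' - k) (l' - l) 1 ltr01.
  move: (ae_conj kl kl'); apply: ae_imp => x [Hx Hx'] /andP[x1 x2].
  have n1 : 1 <= n.+1%:R :> R by rewrite ler1n.
  have : v0 x + comb k l x = v0 x + comb k' l' x.
    by rewrite -Hx ?(ltW x1) ?(ltW x2)// Hx'//; apply/andP; split; lra.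
  by move=> /addrI /eqP; rewrite eq_sym -subr_eq0 => /eqP <-; ring.
by move=> /eqP; rewrite subr_eq0 => /eqP <- /eqP; rewrite subr_eq0 => /eqP <-.
Qed.

End Adjoint.
(** * Cut-off functions and the a priori estimate *)

Section Cutoff.
Variable R : realType.
Local Notation mu := (@lebesgue_measure R).
Variables (P al be : R -> R).
Implicit Types (f g h u v w z d e phi kap psi dpsi : R -> R) (x m M t : R) (n : nat).
Local Notation sol := (qsol P al be).

(* [kap] is phi' and [psi] is p phi', which has to be absolutely continuous for
   [phi v] to lie in the domain of the operator. *)
Definition cutoff (M K : R) phi kap psi dpsi :=
  [/\ ACloc phi kap, ACloc psi dpsi, continuous kap,
      {ae mu, forall x, P x * psi x = kap x} &
      [/\ L2on setT dpsi, L2on setT (fun x => al x * psi x),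
        forall x, 0 <= phi x <= 1, forall x, `|x| <= M -> phi x = 1 &
        [/\ exists M', forall x, M' < `|x| ->
              [/\ phi x = 0, kap x = 0, psi x = 0 & dpsi x = 0],
            forall x, psi x * kap x <= K & forall x, `|x| <= M -> psi x = 0]]].

(** The lower bound is normalised to 1; a shift of the spectral parameter achieves this in
    [real_approximation]. *)
Definition sol_bounded_below := forall g u u1, sol g u u1 ->
  (exists M, forall x, M < `|x| -> u x = 0) -> L2on setT g ->
  \int[mu]_x (u x ^+ 2) <= \int[mu]_x (g x * u x).

Hypothesis IP : Lloc1 P.
Hypothesis Ial : Lloc1 al.
Hypothesis Ibe : Lloc1 be.
Hypothesis LB : sol_bounded_below.

(** For u = phi v the lower bound gives int u^2 <= int phi f u + int psi kap v^2. Half of int u^2 is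
    absorbed through 2 phi f u <= u^2 + f^2, which doubles the remaining constant to 2 K; and since
    psi vanishes on [-M, M], only the mass of v outside that interval is charged. *)
Lemma cutoff_estimate M K phi kap psi dpsi f v v1 : 0 <= K ->
  cutoff M K phi kap psi dpsi -> sol f v v1 -> L2on setT v -> L2on setT f ->
  \int[mu]_(x in `[- M, M]) (v x ^+ 2) <=
    \int[mu]_x (f x ^+ 2) + 2 * K * (\int[mu]_x (v x ^+ 2) -
      \int[mu]_(x in `[- M, M]) (v x ^+ 2)).
Proof.
move=> K0 [Aphi Apsi ckap Ppsi [Ldpsi Lalpsi phi01 phi1 [[M' off] psikap psi0]]] hv Lv Lf.
have [cv cv1] := qsol_continuous hv.
have [cphi cpsi] := (ACloc_continuous Aphi, ACloc_continuous Apsi).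
have [mP mal mbe] : [/\ measurable_fun setT P, measurable_fun setT al & measurable_fun setT be].
  by split; [case: IP|case: Ial|case: Ibe].
have [mv mv1] : measurable_fun setT v /\ measurable_fun setT v1.
  by split; exact: continuous_measurable_fun.
have [mphi mpsi mkap] : [/\ measurable_fun setT phi, measurable_fun setT psi &
    measurable_fun setT kap].
  by split; exact: continuous_measurable_fun.
have [mf mdpsi] : measurable_fun setT f /\ measurable_fun setT dpsi.
  by split; [case: Lf|case: Ldpsi].
pose u x := phi x * v x.
pose u1 x := phi x * v1 x + psi x * v x.
have cu : continuous u by move=> x; apply: cvgM; [exact: cphi|exact: cv].
have cu1 : continuous u1.
  by move=> x; apply: cvgD; apply: cvgM; [exact: cphi|exact: cv1|exact: cpsi|exact: cv].
have [mu_ mu1] : measurable_fun setT u /\ measurable_fun setT u1.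
  by split; exact: continuous_measurable_fun.
(* This is l[phi v]. One [kap x * v1 x] comes from phi' v1, the other from psi v' by P psi = kap;
   likewise one [al x * psi x * v x] comes from psi v', the other from al u1. *)
pose g x := phi x * f x - (2 * (kap x * v1 x) + dpsi x * v x + 2 * (al x * psi x * v x)).
have mg : measurable_fun setT g.
  apply: measurable_funB; first exact: measurable_funM.
  apply: measurable_funD; last by do !apply: measurable_funM => //.
  apply: measurable_funD; last by exact: measurable_funM.
  by do !apply: measurable_funM => //.
have Lphif : L2on setT (fun x => phi x * f x).
  apply: (L2on_le measurableT _ Lf); first exact: measurable_funM.
  move=> x _; rewrite normrM ger0_norm ?ler_piMl//; by case/andP: (phi01 x).
(* The square integrability of [dpsi] and of al psi is used here: each multiplies the continuous v,
   which is bounded on their compact supports, while kap v1 is continuous with compact support. *)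
have Lg : L2on setT g.
  apply: L2onB => //; apply: L2onD => //; first apply: L2onD => //.
  - apply: L2onZ => //; apply: (@L2on_compact _ _ M').
      by move=> x; apply: cvgM; [exact: ckap|exact: cv1].
    by move=> x /off[_ -> _ _]; rewrite mul0r.
  - by apply: (@L2onM_compact _ _ _ M') => // x /off[].
  - apply: L2onZ => //; apply: (@L2onM_compact _ _ _ M') => // x /off[_ _ -> _].
    by rewrite mulr0.
have hu : sol g u u1.
  split.
    apply: ACloc_ae_eq (AClocM Aphi hv.1) _ _.
      by apply: measurable_funD; exact: measurable_funM.
    apply: ae_imp Ppsi => x; rewrite /u /u1 => <-; ring.
  apply: ACloc_ae_eq (AClocD (AClocM Aphi hv.2) (AClocM Apsi hv.1)) _ _.
    apply: measurable_funB; last exact: measurable_funM.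
    by apply: measurable_funB; [exact: measurableT_comp|exact: measurable_funM].
  apply: ae_imp Ppsi => x; rewrite /g /u /u1 => <-; ring.
have u_off x : M' < `|x| -> u x = 0 by move=> /off[e _ _ _]; rewrite /u e mul0r.
have Lu : L2on setT u by exact: L2on_compact u_off.
have main := LB hu (ex_intro _ M' u_off) Lg.
pose W x := psi x * (phi x * (v x * v x)).
(* g u = phi^2 f v + p phi'^2 v^2 - W', and W has compact support *)
have AW := AClocM Apsi (AClocM Aphi (AClocM hv.1 hv.1)).
have Ipp : mu.-integrable setT (EFin \o (fun x => psi x * kap x * v x ^+ 2)).
  have cq : continuous (fun x => psi x * v x).
    by move=> x; apply: cvgM; [exact: cpsi|exact: cv].
  have ck : continuous (fun x => kap x * v x).
    by move=> x; apply: cvgM; [exact: ckap|exact: cv].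
  have : mu.-integrable setT (EFin \o (fun x => (psi x * v x) * (kap x * v x))).
    apply: L2onM => //.
    - by apply: (@L2on_compact _ _ M') => // x /off[_ _ -> _]; rewrite mul0r.
    - by apply: (@L2on_compact _ _ M') => // x /off[_ -> _ _]; rewrite mul0r.
  by congr (is_true (_.-integrable _ _)); apply/funext => x /=; congr EFin; ring.
have Igu := L2onM measurableT Lg Lu.
have Ifu := L2onM measurableT Lphif Lu.
pose G x := g x * u x - (phi x * f x * u x + psi x * kap x * v x ^+ 2).
have IG : mu.-integrable setT (EFin \o G).
  by apply: integrableB_EFin => //; exact: integrableD_EFin.
have AG : ACloc (fun x => - W x) G.
  apply: ACloc_ae_eq (AClocN AW) _ _; first by case/integrableP: IG => /measurable_EFinP.
  apply: ae_imp Ppsi => x; rewrite /G /g /u => <-; ring.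
have W0 x : M' < `|x| -> - W x = 0.
  by move=> /off[_ _ p0 _]; rewrite /W p0 mul0r oppr0.
have := ACloc_integral0 AG IG W0.
rewrite RintegralB//; last exact: integrableD_EFin.
move=> /eqP; rewrite subr_eq0 => /eqP E; rewrite E in main.
set D := `[- M, M]%classic.
have mD : measurable D by exact: measurable_itv.
have [_ Iv] := Lv; have [_ If] := Lf; have [_ Iu] := Lu.
have IDv : mu.-integrable setT (EFin \o (fun x => \1_D x * v x ^+ 2)).
  by apply: integrable_indic_EFin => //; exact: integrableS_EFin Iv.
have le1 : \int[mu]_(x in D) (v x ^+ 2) <= \int[mu]_x (u x ^+ 2).
  rewrite -Rintegral_indic//; apply: le_Rintegral => // x _.
  rewrite indicE; have [xD|xD] := boolP (x \in D); last by rewrite mul0r sqr_ge0.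
  rewrite mul1r /u phi1 ?mul1r//.
  by move: xD; rewrite inE /D/= in_itv/= ler_norml.
pose H x := 2^-1 * u x ^+ 2 + (2^-1 * f x ^+ 2 + K * (v x ^+ 2 - \1_D x * v x ^+ 2)).
have IvD := integrableB_EFin measurableT Iv IDv.
have I2 := integrableZ_EFin (2^-1) measurableT If.
have I3 := integrableZ_EFin K measurableT IvD.
have I1 := integrableZ_EFin (2^-1) measurableT Iu.
have I23 := integrableD_EFin measurableT I2 I3.
have le2 : \int[mu]_x (phi x * f x * u x + psi x * kap x * v x ^+ 2) <= \int[mu]_x H x.
  apply: le_Rintegral => //; first exact: integrableD_EFin.
    exact: integrableD_EFin.
  move=> x _; have /andP[p0 p1] := phi01 x.
  have s1 : phi x * f x * u x <= 2^-1 * u x ^+ 2 + 2^-1 * f x ^+ 2.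
    have : (phi x * f x) ^+ 2 <= f x ^+ 2.
      by rewrite exprMn ler_piMl ?sqr_ge0// expr_le1.
    have := sqr_ge0 (phi x * f x - u x); lra.
  have s2 : psi x * kap x * v x ^+ 2 <= K * (v x ^+ 2 - \1_D x * v x ^+ 2).
    rewrite indicE; have [xD|xD] := boolP (x \in D).
      rewrite mul1r subrr mulr0 psi0 ?mul0r//.
      by move: xD; rewrite inE /D/= in_itv/= ler_norml.
    by rewrite mul0r subr0 ler_wpM2r ?sqr_ge0.
  by rewrite /H; lra.
have E2 : \int[mu]_x H x = 2^-1 * \int[mu]_x (u x ^+ 2) + (2^-1 * \int[mu]_x (f x ^+ 2)
    + K * (\int[mu]_x (v x ^+ 2) - \int[mu]_(x in D) (v x ^+ 2))).
  rewrite RintegralD// RintegralZl// RintegralD// !RintegralZl// RintegralB//.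
  by rewrite Rintegral_indic.
by rewrite E2 in le2; lra.
Qed.

(** Moving the tail to the left gives (1 + 2 K) I_n <= F + 2 K I for the mass I_n on [-n, n]; in the
    limit the terms in K cancel, however large K is. *)
Lemma sol_coercive K f v v1 : 0 <= K ->
  (forall M, exists phi kap psi dpsi, cutoff M K phi kap psi dpsi) ->
  sol f v v1 -> L2on setT v -> L2on setT f ->
  \int[mu]_x (v x ^+ 2) <= \int[mu]_x (f x ^+ 2).
Proof.
move=> K0 HC hv Lv Lf.
have := Rintegral_cvg_itv Lv.2.
set I := \int[mu]_x (v x ^+ 2); set F := \int[mu]_x (f x ^+ 2) => HI.
have H n : (1 + 2 * K) * \int[mu]_(x in `[- n%:R, n%:R]) (v x ^+ 2) <= F + 2 * K * I.
  have [phi [kap [psi [dpsi hc]]]] := HC n%:R.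
  have := cutoff_estimate K0 hc hv Lv Lf; rewrite -/I -/F; lra.
have : (1 + 2 * K) * I <= F + 2 * K * I.
  by apply: (cvgr_to_le (cvgMl_tmp (a := 1 + 2 * K) HI)); apply: nearW; exact: H.
by lra.
Qed.

End Cutoff.

(** * Density of the range *)

Section Density.
Variable R : realType.
Local Notation mu := (@lebesgue_measure R).
Variables (P al be : R -> R).
Hypothesis P0 : {ae mu, forall x, P x != 0}.
Hypothesis IP : Lloc1 P.
Hypothesis Ial : Lloc1 al.
Hypothesis Ibe : Lloc1 be.
Local Notation sol := (qsol P al be).
Implicit Types (f g h u v w z d e : R -> R) (x m M t : R) (n : nat).
Variables (y1 Y1 y2 Y2 : R -> R).
Hypothesis h1 : sol (fun=> 0) y1 Y1.
Hypothesis h2 : sol (fun=> 0) y2 Y2.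
Hypothesis i1 : y1 0 = 1 /\ Y1 0 = 0.
Hypothesis i2 : y2 0 = 0 /\ Y2 0 = 1.
Hypothesis wronskian : forall x, y1 x * Y2 x - Y1 x * y2 x = 1.
Hypothesis coercive : forall f v v1, sol f v v1 -> L2on setT v -> L2on setT f ->
  \int[mu]_x (v x ^+ 2) <= \int[mu]_x (f x ^+ 2).

Local Notation comb k l := (fun x => k * y1 x + l * y2 x).

(** Coercivity with right-hand side 0 leaves no mass to a square integrable solution. *)
Lemma comb_notL2 k l : L2on setT (comb k l) -> k = 0 /\ l = 0.
Proof.
move=> L.
have L0 : L2on setT (fun=> 0 : R).
  by apply: (@L2on_compact _ _ 0) => // x; exact: cvg_cst.
have := coercive (comb_sol h1 h2 k l) L L0.
rewrite (_ : \int[mu]_x (0 ^+ 2) = 0); last first.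
  by under eq_Rintegral do rewrite expr0n; rewrite Rintegral_cst// mul0r.
move=> le0; have E : \int[mu]_x (comb k l x ^+ 2) = 0.
  by apply/eqP; rewrite eq_le le0; apply: Rintegral_ge0 => x _; exact: sqr_ge0.
apply: (comb_ae0 P0 h1 h2 i1 i2 (ltr01 : 0 < 1 :> R)).
by apply: ae_imp (Rintegral_sqr_eq0 measurableT L E) => x H _; exact: H.
Qed.

Lemma ipm_sqr_mono n1 n2 h : continuous h -> (n1 <= n2)%N ->
  ipm n1%:R h h <= ipm n2%:R h h.
Proof.
move=> ch n12; have n12' : n1%:R <= n2%:R :> R by rewrite ler_nat.
rewrite /ipm -[leLHS]Rintegral_indic// -[leRHS]Rintegral_indic//.
have I m : mu.-integrable setT (EFin \o (fun x => \1_(`[- m, m]%classic : set R) x * (h x * h x))).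
  apply: integrable_indic_EFin => //; apply: Lloc1_itv.
  by apply: Lloc1_continuous => x; apply: cvgM; exact: ch.
apply: le_Rintegral => // x _; rewrite ler_wpM2r -?expr2 ?sqr_ge0// !indicE.
have [xD|_] := boolP (x \in (`[- n1%:R, n1%:R]%classic : set R)); last exact: ler0n.
rewrite mem_set//=; move: xD; rewrite inE/= !in_itv/= => /andP[a1 a2].
by apply/andP; split; lra.
Qed.

Let ipm_line d0 e0 t n : continuous d0 -> continuous e0 ->
  ipm n%:R (fun x => d0 x - t * e0 x) (fun x => d0 x - t * e0 x) =
  ipm n%:R d0 d0 - 2 * t * ipm n%:R d0 e0 + t ^+ 2 * ipm n%:R e0 e0.
Proof.
move=> cd ce; have I f g : continuous f -> continuous g ->
    mu.-integrable `[- n%:R, n%:R] (EFin \o (fun x => f x * g x)).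
  by move=> cf cg; apply: Lloc1_itv; apply: Lloc1_continuous => x; apply: cvgM; [exact: cf|exact: cg].
rewrite /ipm (_ : \int[mu]_(x in _) _ = \int[mu]_(x in `[- n%:R, n%:R])
   (d0 x * d0 x - (2 * t) * (d0 x * e0 x) + t ^+ 2 * (e0 x * e0 x))); last first.
  by apply: eq_Rintegral => x _; ring.
have [[I1 I2] I3] := (I _ _ cd cd, I _ _ cd ce, I _ _ ce ce).
rewrite RintegralD//; [|apply: integrableB_EFin => //|]; try exact: integrableZ_EFin.
by rewrite RintegralB//; [rewrite !RintegralZl|exact: integrableZ_EFin].
Qed.

(* If the distances on [-n, n] from the line t |-> d - t e to the origin stayed
   bounded, a cluster point of the minimizing parameters would give a nonzero
   square integrable solution. *)
Lemma span_line_unbounded k l k' l' (K : R) n0 : k * l' - l * k' != 0 ->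
  exists n, (n0 <= n)%N /\ forall t,
    K < ipm n%:R (fun x => comb k l x - t * comb k' l' x)
                 (fun x => comb k l x - t * comb k' l' x).
Proof.
move=> kl; apply: contrapT => /forallNP H.
pose d := comb k l; pose e := comb k' l'.
have [cd ce] : continuous d /\ continuous e.
  by split; exact: (comb_continuous h1 h2).
pose q n t := ipm n%:R (fun x => d x - t * e x) (fun x => d x - t * e x).
have cq t : continuous (fun x => d x - t * e x).
  by move=> x; apply: cvgB; [exact: cd|apply: cvgM; [exact: cvg_cst|exact: ce]].
have {}H n : exists t, (n0 <= n)%N -> q n t <= K.
  have [n0n|nn0] := leqP n0 n; last by exists 0.
  have /not_andP[//|/existsNP[t /negP tK]] := H n.
  by exists t => _; rewrite leNgt.
have [t ht] := choice H.
have q_mono n1 n2 s : (n1 <= n2)%N -> q n1 s <= q n2 s.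
  by move=> n12; exact: ipm_sqr_mono.
pose N := n0.+1.
have E0 : 0 < ipm N%:R e e.
  have := comb_sqr_gt0 P0 h1 h2 i1 i2 (k := k') (l := l') (m := N%:R).
  rewrite (_ : \int[mu]_(x in _) _ = ipm N%:R e e); last first.
    by apply: eq_Rintegral => x _; rewrite expr2.
  apply; first by rewrite ltr0n.
  have [k0|//] := eqVneq k' 0; have [l0|//] := eqVneq l' 0.
  by move: kl; rewrite k0 l0 !mulr0 subrr eqxx.
have D0 : 0 <= ipm N%:R d d.
  by apply: Rintegral_ge0 => x _; rewrite -expr2 sqr_ge0.
(* By the parallelogram law for d and d - t e, t^2 |e|^2 <= 2 |d|^2 + 2 K; adding 1 bounds |t|
   without a square root. *)
pose T := 1 + (2 * ipm N%:R d d + 2 * K) / ipm N%:R e e.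
have tT n : (N <= n)%N -> - T <= t n <= T.
  move=> Nn; have qn : q N (t n) <= K.
    by apply: (le_trans (q_mono N n _ Nn)); apply: ht; exact: ltnW.
  have : 0 <= ipm N%:R (fun x => 2 * d x - t n * e x) (fun x => 2 * d x - t n * e x).
    by apply: Rintegral_ge0 => x _; rewrite -expr2 sqr_ge0.
  rewrite ipm_line//; last by move=> x; apply: cvgM; [exact: cvg_cst|exact: cd].
  have -> : ipm N%:R (fun x => 2 * d x) (fun x => 2 * d x) = 4 * ipm N%:R d d.
    rewrite /ipm -RintegralZl//; last first.
      by apply: Lloc1_itv; apply: Lloc1_continuous => x; apply: cvgM; exact: cd.
    by apply: eq_Rintegral => x _; ring.
  have -> : ipm N%:R (fun x => 2 * d x) e = 2 * ipm N%:R d e.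
    rewrite /ipm -RintegralZl//; last first.
      by apply: Lloc1_itv; apply: Lloc1_continuous => x; apply: cvgM; [exact: cd|exact: ce].
    by apply: eq_Rintegral => x _; ring.
  move: qn; rewrite /q ipm_line// => qn pos.
  have tE : t n ^+ 2 <= (2 * ipm N%:R d d + 2 * K) / ipm N%:R e e.
    by rewrite ler_pdivlMr//; lra.
  by rewrite /T; apply/andP; split; nra.
have cpt : compact `[- T, T] by exact: segment_compact.
have [|s [_ cs]] := cpt (t @ \oo) _.
  by exists N => // n /= Nn; rewrite in_itv/=; exact: tT.
(* For fixed n the sublevel set of the quadratic polynomial [q n] is closed and, by monotonicity in
   n, contains every t_j with j >= n; so it contains the cluster point. *)
have qs n : (n0 <= n)%N -> q n s <= K.
  move=> n0n; have cl : closed [set r | q n r <= K].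
    rewrite (_ : [set r | _] = (fun r => q n r) @^-1` [set r | r <= K])//.
    apply: closed_comp; last exact: closed_le.
    move=> r _; rewrite /q.
    have -> : (fun r => ipm n%:R (fun x => d x - r * e x) (fun x => d x - r * e x))
      = (fun r => ipm n%:R d d - 2 * r * ipm n%:R d e + r ^+ 2 * ipm n%:R e e).
      by apply/funext => r'; exact: ipm_line.
    apply: cvgD; first apply: cvgB; first exact: cvg_cst.
      by apply: cvgM; [apply: cvgM; [exact: cvg_cst|exact: cvg_id]|exact: cvg_cst].
    by apply: cvgM; [apply: cvgM; exact: cvg_id|exact: cvg_cst].
  apply: cl => B Bs; apply: cs => //.
  by exists n => // j /= nj; apply: (le_trans (q_mono _ _ _ nj)); apply: ht; exact: leq_trans nj.
(* Subtracting a multiple of the second row leaves the determinant k l' - l k' unchanged, so (a, b)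
   cannot vanish. *)
pose a := k - s * k'; pose b := l - s * l'.
have E : (fun x => d x - s * e x) = comb a b.
  by apply/funext => x; rewrite /d /e /a /b; ring.
have L : L2on setT (comb a b).
  rewrite -E; apply: (@L2on_bounded _ _ K) => //.
  by exists n0 => // n /= n0n; exact: (qs n n0n).
have [a0 b0] := comb_notL2 L; move: kl => /eqP; apply.
have -> : k * l' - l * k' = a * l' - b * k' by rewrite /a /b; ring.
by rewrite a0 b0 !mul0r subrr.
Qed.

(** With r the part of d orthogonal to e on [-n, n], the function r / |r|^2 has the required moments
    and squared norm 1 / |r|^2. This is below ep once the distance of the line d - t e from the
    origin is large, as [span_line_unbounded] provides. *)
Lemma small_moments (b1 b2 : R) (ep : R) n0 : 0 < ep -> exists n g,
  [/\ (n0 <= n)%N, continuous g, ipm n%:R g g <= ep, ipm n%:R y1 g = b1 & ipm n%:R y2 g = b2].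
Proof.
move=> ep0; have [c1 c2] : continuous y1 /\ continuous y2.
  by split; [exact: (qsol_continuous h1).1|exact: (qsol_continuous h2).1].
have [B BE] : {B : R | B = b1 ^+ 2 + b2 ^+ 2} by exists (b1 ^+ 2 + b2 ^+ 2).
have [b0|bn0] := eqVneq B 0.
  have [-> ->] : b1 = 0 /\ b2 = 0.
    move: b0 => /eqP; rewrite BE paddr_eq0 ?sqr_ge0// !sqrf_eq0.
    by move=> /andP[/eqP ? /eqP ?].
  have Z f : ipm n0%:R f (fun=> 0) = 0.
    by rewrite /ipm; under eq_Rintegral do rewrite mulr0; rewrite Rintegral_cst// mul0r.
  exists n0, (fun=> 0); rewrite !Z ltW//; split => //.
  by move=> x; exact: cvg_cst.
(* A function r of the span with (e, r) = 0 and (d, r) = 1 has moments b1, b2. *)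
pose d := comb (b1 / B) (b2 / B); pose e := comb (- b2) b1.
have kl : b1 / B * b1 - b2 / B * (- b2) != 0.
  rewrite (_ : _ - _ = (b1 ^+ 2 + b2 ^+ 2) / B); last by field.
  by rewrite -BE divff// oner_eq0.
(* Starting from [n0.+1] ensures n > 0, so that the interval is not degenerate. *)
have [n [n0n Hn]] := span_line_unbounded ep^-1 n0.+1 kl.
have n_gt0 : 0 < n%:R :> R by rewrite ltr0n (leq_trans _ n0n).
have [cd ce] : continuous d /\ continuous e.
  by split; exact: (comb_continuous h1 h2).
have LL f : continuous f -> L2on `[- n%:R, n%:R] f by exact: L2on_itv_continuous.
set Ee := ipm n%:R e e.
have Ee0 : 0 < Ee.
  have := comb_sqr_gt0 P0 h1 h2 i1 i2 (k := - b2) (l := b1) n_gt0.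
  rewrite (_ : \int[mu]_(x in _) _ = ipm n%:R e e); last first.
    by apply: eq_Rintegral => x _; rewrite expr2.
  apply; rewrite oppr_eq0 -negb_and; apply/negP => /andP[/eqP b20 /eqP b10].
  by move: bn0; rewrite BE b10 b20 expr0n addr0 eqxx.
have En0 : Ee != 0 by rewrite gt_eqF.
pose t := ipm n%:R d e / Ee.
pose r x := d x - t * e x.
have cr : continuous r.
  by move=> x; apply: cvgB; [exact: cd|apply: cvgM; [exact: cvg_cst|exact: ce]].
have rE : r = (fun x => 1 * d x + (- t) * e x) by apply/funext => x; rewrite /r; ring.
set D := ipm n%:R r r.
have epD : ep^-1 < D by exact: Hn.
have D0 : 0 < D by apply: lt_trans epD; rewrite invr_gt0.
have Dn0 : D != 0 by rewrite gt_eqF.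
have er : ipm n%:R e r = 0.
  rewrite rE ipm_lin//; try exact: LL.
  by rewrite -/Ee ipmC /t; field.
have dr : ipm n%:R d r = D.
  have -> : D = 1 * ipm n%:R r d + (- t) * ipm n%:R r e.
    by rewrite -ipm_lin -?rE//; exact: LL.
  by rewrite [ipm n%:R r e]ipmC er mulr0 addr0 mul1r ipmC.
(* The zero summand only brings the scaled function into the form of [ipm_lin]. *)
exists n, (fun x => D^-1 * r x + 0 * r x).
have gE f : continuous f -> ipm n%:R f (fun x => D^-1 * r x + 0 * r x) = D^-1 * ipm n%:R f r.
  by move=> cf; rewrite ipm_lin//; try exact: LL; rewrite mul0r addr0.
have cg : continuous (fun x => D^-1 * r x + 0 * r x).
  by move=> x; apply: cvgD; apply: cvgM; by [exact: cvg_cst|exact: cr].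
split => //; first exact: ltnW.
- rewrite gE// ipmC gE// -/D mulVf// mulr1.
  by rewrite -[leRHS]invrK lef_pV2 ?ltW// posrE// invr_gt0.
- rewrite gE//; have -> : y1 = (fun x => b1 * d x + (- (b2 / B)) * e x).
    apply/funext => x; rewrite /d /e.
    by rewrite -[LHS]mul1r -(divff bn0) {1}BE; field.
  rewrite ipmC ipm_lin; try exact: LL.
  by rewrite (ipmC _ r d) (ipmC _ r e) er dr mulr0 addr0 mulrCA mulVf// mulr1.
- rewrite gE//; have -> : y2 = (fun x => b2 * d x + (b1 / B) * e x).
    apply/funext => x; rewrite /d /e.
    by rewrite -[LHS]mul1r -(divff bn0) {1}BE; field.
  rewrite ipmC ipm_lin; try exact: LL.
  by rewrite (ipmC _ r d) (ipmC _ r e) er dr mulr0 addr0 mulrCA mulVf// mulr1.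
Qed.

(** Truncate f to [-k, k] and subtract a small g on a larger [-n, n] with the same two moments;
    [qsol_range] then applies. Tail and correction each have squared norm at most ep / 4, and the
    square of their sum costs a factor 2 on each. *)
Lemma range_dense f (ep : R) : L2on setT f -> 0 < ep ->
  exists u u1 g, [/\ sol g u u1, exists M, forall x, M < `|x| -> u x = 0,
    L2on setT g & \int[mu]_x ((g x - f x) ^+ 2) <= ep].
Proof.
move=> Lf ep0; have If := L2on_Lloc1 Lf.
have [c1 c2] : continuous y1 /\ continuous y2.
  by split; [exact: (qsol_continuous h1).1|exact: (qsol_continuous h2).1].
have := Rintegral_cvg_itv Lf.2; set F := \int[mu]_x (f x ^+ 2) => cF.
have [k hk] : exists k : nat, F - \int[mu]_(x in `[- k%:R, k%:R]) (f x ^+ 2) <= ep / 4.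
  have e4 : 0 < ep / 4 by rewrite divr_gt0.
  move/cvgrPdist_le : cF => /(_ _ e4)[k _ /(_ k (leqnn k))] /= H.
  by exists k; exact: (le_trans (ler_norm _) H).
pose Dk := `[- k%:R, k%:R]%classic : set R.
have mDk : measurable Dk by exact: measurable_itv.
have e4 : 0 < ep / 4 by rewrite divr_gt0.
have [n [g [kn cg gg g1 g2]]] :=
  small_moments (\int[mu]_(x in Dk) (y1 x * f x)) (\int[mu]_(x in Dk) (y2 x * f x)) k e4.
pose Dn := `[- n%:R, n%:R]%classic : set R.
have mDn : measurable Dn by exact: measurable_itv.
have kn' : k%:R <= n%:R :> R by rewrite ler_nat.
have Dkn : Dk `<=` Dn.
  by move=> x; rewrite /Dk /Dn /= !in_itv/= => /andP[? ?]; apply/andP; split; lra.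
pose h x := \1_Dk x * f x - \1_Dn x * g x.
have L1 : L2on setT (fun x => \1_Dk x * f x) by apply: L2on_indic => //; exact: L2onS Lf.
have L2 : L2on setT (fun x => \1_Dn x * g x).
  by apply: L2on_indic => //; exact: L2on_itv_continuous.
have Lh : L2on setT h by exact: L2onB.
have h_off x : n%:R < `|x| -> h x = 0.
  move=> nx; have xDn : ~ Dn x.
    by rewrite /Dn/= in_itv/= -ler_norml leNgt nx.
  rewrite /h !indicE !memNset// ?mul0r ?subrr//.
  by move=> /Dkn.
have ho (y : R -> R) : continuous y -> \int[mu]_(x in Dn) (y x * h x) =
    \int[mu]_(x in Dk) (y x * f x) - ipm n%:R y g.
  move=> cy; have Iyf : Lloc1 (fun x => y x * f x) by exact: Lloc1M.
  have Iyg : Lloc1 (fun x => y x * g x) by apply: Lloc1M => //; exact: Lloc1_continuous.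
  rewrite /ipm -(Rintegral_indic (fun x => y x * f x) mDk).
  rewrite -(Rintegral_indic (fun x => y x * g x) mDn) -Rintegral_indic//.
  rewrite -RintegralB//; try by apply: integrable_indic_EFin => //; exact: Lloc1_itv.
  apply: eq_Rintegral => x _; rewrite /h !indicE.
  have [xn|xn] := boolP (x \in Dn); first by rewrite /= !mul1r; ring.
  have [xk|xk] := boolP (x \in Dk); last by rewrite /= !mul0r subrr.
  by move: xk xn; rewrite inE => /Dkn xDn /negP[]; rewrite inE.
have [u [u1 [hu u0]]] : exists u u1, sol h u u1 /\ forall x, n%:R < `|x| -> u x = 0.
  apply: (qsol_range h1 h2 wronskian) => //; first exact: L2on_Lloc1.
  - by rewrite ho// g1 subrr.
  - by rewrite ho// g2 subrr.
exists u, u1, h; split => //; first by exists n%:R.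
have If2 := Lf.2.
have Ik2 : mu.-integrable setT (EFin \o (fun x => \1_Dk x * f x ^+ 2)).
  by apply: integrable_indic_EFin => //; exact: integrableS_EFin If2.
have Ig2 : mu.-integrable setT (EFin \o (fun x => \1_Dn x * (g x * g x))).
  apply: integrable_indic_EFin => //; apply: Lloc1_itv; apply: Lloc1_continuous => x.
  by apply: cvgM; exact: cg.
have J1 := integrableZ_EFin 2 measurableT (integrableB_EFin measurableT If2 Ik2).
have J2 := integrableZ_EFin 2 measurableT Ig2.
apply: (@le_trans _ _ (\int[mu]_x (2 * (f x ^+ 2 - \1_Dk x * f x ^+ 2)
    + 2 * (\1_Dn x * (g x * g x))))).
  apply: le_Rintegral => //.
  - by have [] := L2onB measurableT Lh Lf.
  - exact: integrableD_EFin.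
  move=> x _; rewrite /h !indicE.
  have [xk|xk] := boolP (x \in Dk).
    have -> : x \in Dn by rewrite inE; apply: Dkn; rewrite inE in xk.
    by rewrite /= !mul1r; have := sqr_ge0 (g x); nra.
  case: (x \in Dn); rewrite /= ?mul1r !mul0r; last by have := sqr_ge0 (f x); nra.
  by have := sqr_ge0 (f x - g x); nra.
rewrite RintegralD// !RintegralZl//; last exact: integrableB_EFin.
rewrite RintegralB// !Rintegral_indic// -/F -/(ipm n%:R g g).
have : F - \int[mu]_(x in Dk) (f x ^+ 2) <= ep / 4 by [].
by move: gg; lra.
Qed.

End Density.

(** * Construction of the cut-off functions from the intervals *)

Section Ramp.
Variable R : realType.
Local Notation mu := (@lebesgue_measure R).
Implicit Types (f g h p Q phi kap psi dpsi : R -> R) (a b x M K C : R).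

Lemma L2on_ae_eq f g : L2on setT f -> measurable_fun setT g ->
  {ae mu, forall x, f x = g x} -> L2on setT g.
Proof.
move=> [mf If] mg fg; split=> //.
apply/integrableP; split; first by apply/measurable_EFinP; exact: measurable_funX.
have /integrableP[_] := If; congr (_ < _)%E.
apply: ae_eq_integral => //=.
- by do 2 apply: measurableT_comp => //; exact: measurable_funX.
- by do 2 apply: measurableT_comp => //; exact: measurable_funX.
by apply: ae_imp fg => x /= -> _.
Qed.

Lemma integrable_indic_Lloc1 (D : set R) f : measurable D ->
  mu.-integrable D (EFin \o f) -> Lloc1 (fun x => \1_D x * f x).
Proof.
move=> mD If; have I := integrable_indic_EFin mD If.
split; first by case/integrableP: I => /measurable_EFinP.
by move=> a b; exact: integrableS_EFin I.
Qed.

Lemma ACloc_ramp a b : a < b -> exists t : R -> R,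
  [/\ ACloc t (fun x => \1_(`[a, b]%classic : set R) x * (b - a)^-1),
      forall x, x <= a -> t x = 0, forall x, b <= x -> t x = 1 &
      forall x, 0 <= t x <= 1].
Proof.
move=> ab; set g := fun x => _.
have ba : 0 < b - a by rewrite subr_gt0.
have Ig : Lloc1 g by apply: Lloc1_indic => //; exact: Lloc1_cst.
have A := ACloc_prim Ig.
pose t x := prim g x - prim g a.
have At : ACloc t g.
  by apply: ACloc_eq (AClocB A (ACloc_cst (prim g a))) => x //; rewrite subr0.
have ta : t a = 0 by rewrite /t subrr.
have goff x : ~~ (a <= x <= b) -> g x = 0.
  move=> xab; rewrite /g indicE memNset ?mul0r//= in_itv/=; exact/negP.
have t0 x : x <= a -> t x = 0.
  move=> xa; have := ACloc_Rintegral At xa; rewrite ta.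
  rewrite Rintegral_itv0//.
    by move=> /eqP; rewrite eq_sym sub0r oppr_eq0 => /eqP.
  by move=> y /andP[_ ya]; apply: goff; rewrite leNgt ya.
have tb : t b = 1.
  have := ACloc_Rintegral At (ltW ab); rewrite ta subr0 => <-.
  rewrite (@eq_Rintegral _ _ _ mu _ (fun=> (b - a)^-1)); last first.
    by move=> x xD; rewrite /g indicE xD mul1r.
  rewrite Rintegral_cst//.
  have E : mu `[a, b]%classic = (b - a)%:E.
    by rewrite lebesgue_measure_itv/= lte_fin ab EFinB.
  by rewrite [X in fine X]E/= mulVf// gt_eqF.
have t1 x : b <= x -> t x = 1.
  move=> bx; have := ACloc_Rintegral At bx; rewrite tb.
  rewrite Rintegral_itv0//; first by move=> /eqP; rewrite eq_sym subr_eq0 => /eqP.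
  by move=> y /andP[yb _]; apply: goff; rewrite (leNgt y) yb andbF.
have mono x y : x <= y -> t x <= t y.
  move=> xy; rewrite -subr_ge0 -(ACloc_Rintegral At xy).
  by apply: Rintegral_ge0 => z _; rewrite /g mulr_ge0// ?invr_ge0 ?ltW.
exists t; split => // x; apply/andP; split.
  have [xa|ax] := leP x a; first by rewrite t0.
  by rewrite -ta mono// ltW.
have [xb|bx] := leP x b; first by rewrite -tb mono.
by rewrite t1// ltW.
Qed.

(* As in [cutoff], [kap] is phi' and [psi] is p phi'. *)
Definition ramp p Q a b K phi kap psi dpsi :=
  [/\ ACloc phi kap, ACloc psi dpsi, continuous kap,
      {ae mu, forall x, (p x)^-1 * psi x = kap x} &
      [/\ L2on setT dpsi, L2on setT (fun x => Q x / p x * psi x),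
        forall x, 0 <= phi x <= 1,
        (forall x, x <= a -> phi x = 0) /\ (forall x, b <= x -> phi x = 1) &
        (forall x, ~~ (a <= x <= b) -> [/\ kap x = 0, psi x = 0 & dpsi x = 0]) /\
        (forall x, psi x * kap x <= K)]].

(** With t the linear ramp, phi' = 6 t (1 - t) / (b - a) is at most (3 / 2) / (b - a); its square
    times p <= C (b - a)^2 yields the constant 9 / 4 C. *)
Lemma ramp_exists p Q a b C (pn dpn : R -> R) :
  measurable_fun setT (fun x => Q x / p x) ->
  Lloc2 (fun x => Q x / Num.sqrt `|p x|) -> a < b ->
  mu.-integrable `[a, b] (EFin \o dpn) -> L2on `[a, b] dpn ->
  (forall x, a <= x <= b -> (\int[mu]_(t in `[a, x]) (dpn t)%:E)%E = (pn x - pn a)%:E) ->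
  {ae mu, forall x, a <= x <= b -> p x = pn x} ->
  (forall x, a <= x <= b -> 0 < pn x /\ pn x <= C * (b - a) ^+ 2) ->
  exists phi kap psi dpsi, ramp p Q a b (9 / 4 * C) phi kap psi dpsi.
Proof.
move=> mal [mW IW] ab Idpn Ldpn pnE ppn pnC.
have mD : measurable (`[a, b]%classic : set R) by exact: measurable_itv.
have ba : 0 < b - a by rewrite subr_gt0.
have [t [At t0 t1 t01]] := ACloc_ramp ab.
set D := (`[a, b]%classic : set R) in mD At.
have inD x : (x \in D) = (a <= x <= b).
  by apply/idP/idP; rewrite inE /D/= in_itv.
have out x : `|a| + `|b| < `|x| -> x \notin D.
  have := ler_norm b; have := ler_norm (- a); rewrite normrN.
  have := normr_ge0 a; have := normr_ge0 b => ? ? ? ?; rewrite inD.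
  by rewrite ltr_normr negb_and -!ltNge => /orP[?|?]; apply/orP; [right|left]; lra.
pose s := (b - a)^-1.
pose G x := \1_D x * dpn x.
have IG : Lloc1 G by exact: integrable_indic_Lloc1.
have LG : L2on setT G by exact: L2on_indic.
(* An absolutely continuous extension of [pn] to the line, constant outside [a, b]; p itself is
   uncontrolled there. *)
pose pe x := prim G x - prim G a + pn a.
have Ape : ACloc pe G.
  apply: ACloc_eq (AClocD (AClocB (ACloc_prim IG) (ACloc_cst (prim G a))) (ACloc_cst (pn a))) => x //.
  by rewrite subr0 addr0.
have pepn x : a <= x <= b -> pe x = pn x.
  move=> /andP[ax xb]; rewrite /pe -(ACloc_Rintegral (ACloc_prim IG) ax).
  rewrite (@eq_Rintegral _ _ _ mu _ dpn) => [|y yD].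
    by rewrite /Rintegral pnE ?ax//= subrK.
  rewrite /G indicE inD; move: yD; rewrite inE/= in_itv/= => /andP[-> yx].
  by rewrite (le_trans yx xb) mul1r.
pose kap x := 6 * s * (t x * (1 - t x)).
pose dkap x := \1_D x * (6 * s * s * (1 - 2 * t x)).
(* phi is the smoothstep of t, so that phi' is still absolutely continuous *)
pose phi x := 3 * t x ^+ 2 - 2 * t x ^+ 3.
have t_off x : x \notin D -> t x * (1 - t x) = 0.
  rewrite inD negb_and -!ltNge => /orP[xa|xb].
    by rewrite t0 ?mul0r// ltW.
  by rewrite t1 ?subrr ?mulr0// ltW.
have Aphi : ACloc phi kap.
  apply: ACloc_eq (AClocB (AClocZ 3 (AClocX 1 At)) (AClocZ 2 (AClocX 2 At))) => x //.
  rewrite /kap -/s indicE; have [xD|xD] := boolP (x \in D); first by rewrite /=; ring.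
  by rewrite t_off// /=; ring.
have Akap : ACloc kap dkap.
  apply: ACloc_eq (AClocZ (6 * s) (AClocM At (AClocB (ACloc_cst 1) At))) => x //.
  by rewrite /dkap -/s; ring.
have ckap := ACloc_continuous Akap.
have ct := ACloc_continuous At.
have cpe := ACloc_continuous Ape.
pose psi x := pe x * kap x.
pose dpsi x := G x * kap x + pe x * dkap x.
have Apsi : ACloc psi dpsi by exact: AClocM.
have kap_off x : x \notin D -> kap x = 0.
  by move=> /t_off xD; rewrite /kap xD mulr0.
have ppe : {ae mu, forall x, x \in D -> p x = pe x /\ 0 < pe x}.
  apply: ae_imp ppn => x H; rewrite inD => xD.
  by rewrite pepn// (pnC x xD).1; split => //; exact: H.
exists phi, kap, psi, dpsi; split => //.
  apply: ae_imp ppe => x H; have [xD|xD] := boolP (x \in D).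
    by have [-> pe0] := H xD; rewrite /psi mulKf// gt_eqF.
  by rewrite /psi kap_off// !mulr0.
split.
- apply: L2onD => //.
    apply: (@L2onM_compact _ _ _ (`|a| + `|b|)) => //.
      exact: continuous_measurable_fun.
    by move=> x /out xD; rewrite /G indicE (negbTE xD) mul0r.
  rewrite (_ : (fun x => _) = (fun x => \1_D x * (pe x * (6 * s * s * (1 - 2 * t x))))); last first.
    by apply/funext => x; rewrite /dkap mulrCA.
  apply: L2on_indic => //; apply: L2on_itv_continuous => x.
  apply: cvgM; first exact: cpe.
  apply: cvgM; first exact: cvg_cst.
  by apply: cvgB; [exact: cvg_cst|apply: cvgM; [exact: cvg_cst|exact: ct]].
- (* al psi = Q phi' = (Q / sqrt p) (sqrt p phi') on [a, b] *)
  pose W x := \1_D x * (Q x / Num.sqrt `|p x|).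
  have LW : L2on setT W.
    by apply: L2on_indic => //; split; [exact: measurable_funTS|exact: Lloc1_itv].
  have ch : continuous (fun x => Num.sqrt `|pe x| * kap x).
    move=> x; apply: cvgM; last exact: ckap.
    apply: (@continuous_comp _ _ _ (fun x => `|pe x|) Num.sqrt); last exact: sqrt_continuous.
    by apply: (@continuous_comp _ _ _ pe); [exact: cpe|exact: norm_continuous].
  have : L2on setT (fun x => W x * (Num.sqrt `|pe x| * kap x)).
    apply: (@L2onM_compact _ _ _ (`|a| + `|b|)) => //.
      exact: continuous_measurable_fun.
    by move=> x /out xD; rewrite /W indicE (negbTE xD) mul0r.
  move=> /L2on_ae_eq; apply.
    by apply: measurable_funM => //; exact: continuous_measurable_fun (ACloc_continuous Apsi).
  apply: ae_imp ppe => x H; rewrite /W /psi indicE.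
  have [xD|xD] := boolP (x \in D); last by rewrite kap_off// !mulr0.
  have [-> pe0] := H xD; rewrite mul1r gtr0_norm//.
  have sp : Num.sqrt (pe x) != 0 by rewrite gt_eqF// sqrtr_gt0.
  by rewrite [LHS]mulrA [RHS]mulrA !divfK// gt_eqF.
- move=> x; have /andP[tx0 tx1] := t01 x; rewrite /phi.
  have h2 : 0 <= t x ^+ 2 by exact: sqr_ge0.
  have h3 : 0 <= (1 - t x) ^+ 2 by exact: sqr_ge0.
  have -> : 3 * t x ^+ 2 - 2 * t x ^+ 3 = t x ^+ 2 * (3 - 2 * t x) by ring.
  apply/andP; split; first by rewrite mulr_ge0//; lra.
  rewrite -subr_ge0 (_ : 1 - _ = (1 - t x) ^+ 2 * (1 + 2 * t x)); last by ring.
  by rewrite mulr_ge0//; lra.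
- split=> x xa; rewrite /phi; first by rewrite t0// !expr0n /= !mulr0 subrr.
  by rewrite t1// !expr1n !mulr1; ring.
split=> x.
  rewrite -inD => xD; rewrite /dpsi /psi /dkap /G kap_off// indicE (negbTE xD).
  by rewrite !mul0r !mulr0 addr0.
rewrite /psi; have [xD|xD] := boolP (x \in D); last first.
  rewrite kap_off// !mulr0.
  (* Off the interval the product is 0, so the bound amounts to C >= 0, which is read off from the
     two inequalities at a. *)
  have [p1 p2] : 0 < pn a /\ pn a <= C * (b - a) ^+ 2 by apply: pnC; rewrite lexx ltW.
  have : 0 < C * (b - a) ^+ 2 by exact: lt_le_trans p2.
  by rewrite pmulr_lgt0 ?exprn_gt0// => C0; lra.
have xab : a <= x <= b by rewrite -inD.
have [pn0 pnx] := pnC x xab; rewrite pepn//.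
have q0 : 0 <= t x * (1 - t x) by have /andP[? ?] := t01 x; rewrite mulr_ge0//; lra.
have q1 : t x * (1 - t x) <= 1 / 4 by have := sqr_ge0 (1 - 2 * t x); lra.
have q2 : (t x * (1 - t x)) ^+ 2 <= (1 / 4) ^+ 2 by rewrite ler_sqr ?nnegrE//; lra.
have -> : pn x * kap x * kap x = pn x * (36 * s ^+ 2 * (t x * (1 - t x)) ^+ 2).
  by rewrite /kap; ring.
have s0 : 0 < s by rewrite invr_gt0.
apply: (@le_trans _ _ (C * (b - a) ^+ 2 * (36 * s ^+ 2 * (1 / 4) ^+ 2))).
  apply: ler_pM => //; first exact: ltW.
    by apply: mulr_ge0; [apply: mulr_ge0 => //; exact: sqr_ge0|exact: sqr_ge0].
  by rewrite ler_wpM2l//; apply: mulr_ge0 => //; exact: sqr_ge0.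
rewrite le_eqVlt; apply/orP; left; apply/eqP; rewrite /s.
by field; rewrite gt_eqF.
Qed.

(** One ramp rises to the left of - |M|, the other to the right of |M|, so the difference is a
    plateau. The two transition intervals are disjoint, and the sign change of the second ramp drops
    out of psi kap, so K is not enlarged. *)
Lemma cutoff_of_ramps p Q a1 b1 a2 b2 M K phi1 kap1 psi1 dpsi1 phi2 kap2 psi2 dpsi2 :
  a1 < b1 -> a2 < b2 -> b1 < - `|M| -> `|M| < a2 ->
  ramp p Q a1 b1 K phi1 kap1 psi1 dpsi1 -> ramp p Q a2 b2 K phi2 kap2 psi2 dpsi2 ->
  cutoff (fun x => (p x)^-1) (fun x => Q x / p x) M K
    (fun x => phi1 x - phi2 x) (fun x => kap1 x - kap2 x)
    (fun x => psi1 x - psi2 x) (fun x => dpsi1 x - dpsi2 x).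
Proof.
move=> ab1 ab2 b1M a2M.
move=> [A1 B1 c1 e1 [L1 Q1 p1 [z1 o1] [s1 k1]]].
move=> [A2 B2 c2 e2 [L2 Q2 p2 [z2 o2] [s2 k2]]].
have M0 := normr_ge0 M.
split; [exact: AClocB|exact: AClocB| | |split].
- by move=> x; apply: cvgB; [exact: c1|exact: c2].
- by apply: ae_imp (ae_conj e1 e2) => x [<- <-]; rewrite mulrBr.
- exact: L2onB.
- rewrite (_ : (fun x => _) = (fun x => Q x / p x * psi1 x - Q x / p x * psi2 x)).
    exact: L2onB.
  by apply/funext => x; rewrite mulrBr.
- move=> x; have [/andP[? ?] /andP[? ?]] := (p1 x, p2 x).
  have [xa|ax] := leP x a2; first by rewrite z2// subr0; apply/andP.
  by rewrite o1; [apply/andP; split; lra|lra].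
- move=> x xM; have := le_trans xM (ler_norm M); rewrite ler_norml => /andP[? ?].
  by rewrite o1 ?z2 ?subr0//; lra.
split.
- exists (`|a1| + `|b2|) => x.
  have := ler_norm b2; have := ler_norm (- a1); rewrite normrN.
  have := normr_ge0 a1; have := normr_ge0 b2 => ? ? ? ?.
  rewrite ltr_normr => /orP[xb|xa].
    have [|-> -> ->] := s1 x; first by rewrite negb_and -!ltNge; apply/orP; right; lra.
    have [|-> -> ->] := s2 x; first by rewrite negb_and -!ltNge; apply/orP; right; lra.
    by rewrite o1 ?o2 ?subrr//; lra.
  have [|-> -> ->] := s1 x; first by rewrite negb_and -!ltNge; apply/orP; left; lra.
  have [|-> -> ->] := s2 x; first by rewrite negb_and -!ltNge; apply/orP; left; lra.
  by rewrite z1 ?z2 ?subrr//; lra.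
- move=> x; have [xb|bx] := leP x b1.
    have [|-> -> _] := s2 x; first by rewrite negb_and -!ltNge; apply/orP; left; lra.
    by rewrite !subr0.
  have [|-> -> _] := s1 x; first by rewrite negb_and -!ltNge; apply/orP; right; lra.
  by rewrite !sub0r mulrNN.
- move=> x xM; have := le_trans xM (ler_norm M); rewrite ler_norml => /andP[? ?].
  have [|_ -> _] := s1 x; first by rewrite negb_and -!ltNge; apply/orP; right; lra.
  have [|_ -> _] := s2 x; first by rewrite negb_and -!ltNge; apply/orP; left; lra.
  by rewrite subrr.
Qed.

End Ramp.
(** * The gauge transformation *)

Section Coefficients.
Variable R : realType.
Local Notation mu := (@lebesgue_measure R).
Variables (p Q r s : R -> R).
Hypothesis A : standing_A p Q r s.

Let w x := 1 / Num.sqrt `|p x|.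

Let w2 x : w x ^+ 2 = `|p x|^-1.
Proof. by rewrite /w div1r exprVn sqr_sqrtr. Qed.

Let mw : measurable_fun setT w.
Proof. by case: A => _ [_ [_ [_ [[]]]]]. Qed.

Lemma standing_measurable : [/\ measurable_fun setT p, measurable_fun setT Q,
  measurable_fun setT r & measurable_fun setT s].
Proof. by case: A => ? [? [? [? _]]]. Qed.

(** Here 1 / p = p (1 / |p|)^2 with 1 / |p| = w^2 measurable; the identity also holds at p x = 0,
    where inverses are 0. *)
Lemma measurable_inv_p : measurable_fun setT (fun x => (p x)^-1).
Proof.
have [mp _ _ _] := standing_measurable.
rewrite (_ : (fun x => _) = (fun x => p x * (w x ^+ 2 * w x ^+ 2))).
  by do !apply: measurable_funM => //; exact: measurable_funX.
apply/funext => x; rewrite w2; have [->|p0] := eqVneq (p x) 0.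
  by rewrite invr0 mul0r.
by rewrite -invfM -normrM ger0_norm -?expr2 ?sqr_ge0// expr2 invfM mulrA divff// mul1r.
Qed.

Lemma Lloc1_inv_p : Lloc1 (fun x => (p x)^-1).
Proof.
have [_ Iw] : Lloc2 w by case: A => _ [_ [_ [_ [? _]]]].
apply: (Lloc1_le measurable_inv_p Iw) => x.
by rewrite normfV [leRHS]w2.
Qed.

Let wM (g : R -> R) : (fun x => g x / Num.sqrt `|p x|) = (fun x => g x * w x).
Proof. by apply/funext => x; rewrite /w div1r. Qed.

Let Lloc1_div (g : R -> R) : measurable_fun setT g ->
  Lloc2 (fun x => g x / Num.sqrt `|p x|) -> Lloc1 (fun x => g x / p x).
Proof.
move=> mg; rewrite wM => Ig.
have Iw : Lloc2 w by case: A => _ [_ [_ [_ [? _]]]].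
have mgp : measurable_fun setT (fun x => g x / p x).
  by apply: measurable_funM => //; exact: measurable_inv_p.
apply: (Lloc1_le mgp (Lloc1_norm (Lloc2M Ig Iw))) => x.
by rewrite -mulrA -expr2 w2 !normrM !normfV normr_id.
Qed.

Let Lloc1_sqr_div (g : R -> R) : measurable_fun setT g ->
  Lloc2 (fun x => g x / Num.sqrt `|p x|) -> Lloc1 (fun x => g x ^+ 2 / p x).
Proof.
move=> mg; rewrite wM => -[_ Ig].
have mgp : measurable_fun setT (fun x => g x ^+ 2 / p x).
  by apply: measurable_funM; [exact: measurable_funX|exact: measurable_inv_p].
apply: (Lloc1_le mgp Ig) => x.
by rewrite exprMn w2 normrM normfV ger0_norm// sqr_ge0.
Qed.

Lemma Lloc1_Q_p : Lloc1 (fun x => Q x / p x).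
Proof.
have [_ mQ _ _] := standing_measurable.
by apply: Lloc1_div => //; case: A => _ [_ [_ [_ [_ []]]]].
Qed.

Lemma Lloc1_r_p : Lloc1 (fun x => r x / p x).
Proof.
have [_ _ mr _] := standing_measurable.
by apply: Lloc1_div => //; case: A => _ [_ [_ [_ [_ [_ []]]]]].
Qed.

Lemma Lloc1_potential : Lloc1 (fun x => (Q x ^+ 2 + r x ^+ 2) / p x - s x).
Proof.
have [_ mQ mr _] := standing_measurable.
case: A => _ [_ [_ [_ [_ [IQ [Ir [Is _]]]]]]].
apply: Lloc1B => //; under eq_fun do rewrite mulrDl.
by apply: Lloc1D; exact: Lloc1_sqr_div.
Qed.

Lemma ae_inv_p_neq0 : {ae mu, forall x, (p x)^-1 != 0}.
Proof.
case: A => _ [_ [_ [_ [_ [_ [_ [_]]]]]]].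
by apply: ae_imp => x; rewrite invr_eq0.
Qed.

End Coefficients.

Section Gauge.
Variable R : realType.
Local Notation mu := (@lebesgue_measure R).
Local Notation Cf := (R -> R[i]).
Variables (p Q r s : R -> R).
Hypothesis A : standing_A p Q r s.

Local Notation P := (fun x => (p x)^-1).
Local Notation al := (fun x => Q x / p x).
Local Notation rho := (fun x => r x / p x).
Local Notation be := (fun x => (Q x ^+ 2 + r x ^+ 2) / p x - s x).
Local Notation sol := (qsol P al be).

(* (co, si) = (cos theta, sin theta) with theta' = r / p; taking them as a
   solution of a linear system avoids a chain rule for theta. *)
Lemma gauge_exists : exists co si : R -> R,
  [/\ ACloc co (fun x => - (rho x * si x)), ACloc si (fun x => rho x * co x) &
      forall x, co x ^+ 2 + si x ^+ 2 = 1].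
Proof.
have Ir := Lloc1_r_p A.
pose a i j : R -> R := match i, j with
  | true, false => fun x => - rho x | false, true => rho | _, _ => fun=> 0 end.
have Ia i j : Lloc1 (a i j).
  by case: i; case: j => /=; [exact: Lloc1_cst|exact: Lloc1N|exact: Ir|exact: Lloc1_cst].
have [u [u0 hu]] := linear_system_solution (fun c : bool => c%:R : R) Ia.
have h1 : ACloc (u true) (fun x => - (rho x * u false x)).
  by apply: ACloc_eq (hu true) => x //=; rewrite mul0r add0r mulNr.
have h2 : ACloc (u false) (fun x => rho x * u true x).
  by apply: ACloc_eq (hu false) => x //=; rewrite mul0r addr0.
exists (u true), (u false); split => // x.
have /ACloc0_const E : ACloc (fun x => u true x * u true x + u false x * u false x) (fun=> 0).
  by apply: ACloc_eq (AClocD (AClocM h1 h1) (AClocM h2 h2)) => t //; ring.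
by have := E x 0; rewrite !u0/= -!expr2 expr1n expr0n addr0.
Qed.

Lemma quasi_derivativeE (P' Q' r' : R) (z u : R[i]) :
  RC P' * z - (RC Q' + 'i * RC r') * u =
  Complex (P' * complex.Re z - Q' * complex.Re u + r' * complex.Im u)
          (P' * complex.Im z - Q' * complex.Im u - r' * complex.Re u).
Proof.
case: z => z1 z2; case: u => u1 u2; rewrite -complexiE /RC.
by apply/eqP; rewrite eq_complex /=; apply/andP; split; apply/eqP; ring.
Qed.

Lemma quasi_expressionE (P' Q' r' k : R) (z v u : R[i]) :
  - (z + (RC Q' - 'i * RC r') / RC P' * v + RC k * u) =
  Complex (- (complex.Re z + Q' / P' * complex.Re v + r' / P' * complex.Im v + k * complex.Re u))
          (- (complex.Im z + Q' / P' * complex.Im v - r' / P' * complex.Re v + k * complex.Im u)).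
Proof.
have -> : (RC P')^-1 = RC P'^-1 by rewrite /RC -[LHS](fmorphV (real_complex R)).
case: z => z1 z2; case: u => u1 u2; case: v => v1 v2; rewrite -complexiE /RC.
by apply/eqP; rewrite eq_complex /=; apply/andP; split; apply/eqP; ring.
Qed.

Variables (co si : R -> R).
Hypothesis Aco : ACloc co (fun x => - (rho x * si x)).
Hypothesis Asi : ACloc si (fun x => rho x * co x).
Hypothesis cs1 : forall x, co x ^+ 2 + si x ^+ 2 = 1.

(** Real part of exp(-i theta) u; [ungauge2] is the imaginary part, and [gauge] multiplies a + i b
    by exp(i theta). *)
Definition ungauge1 (u : Cf) x := co x * reF u x + si x * imF u x.
Definition ungauge2 (u : Cf) x := co x * imF u x - si x * reF u x.
Definition gauge (a b : R -> R) : Cf :=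
  fun x => Complex (co x * a x - si x * b x) (si x * a x + co x * b x).

Lemma ungauge1K a b x : ungauge1 (gauge a b) x = a x.
Proof.
rewrite /ungauge1 /reF /imF /=; transitivity ((co x ^+ 2 + si x ^+ 2) * a x); first by ring.
by rewrite cs1 mul1r.
Qed.

Lemma ungauge2K a b x : ungauge2 (gauge a b) x = b x.
Proof.
rewrite /ungauge2 /reF /imF /=; transitivity ((co x ^+ 2 + si x ^+ 2) * b x); first by ring.
by rewrite cs1 mul1r.
Qed.

Lemma gaugeK u x : gauge (ungauge1 u) (ungauge2 u) x = u x.
Proof.
rewrite /gauge /ungauge1 /ungauge2 /reF /imF; case: (u x) => a b /=; congr Complex.
  by transitivity ((co x ^+ 2 + si x ^+ 2) * a); [ring|rewrite cs1 mul1r].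
by transitivity ((co x ^+ 2 + si x ^+ 2) * b); [ring|rewrite cs1 mul1r].
Qed.

Lemma gauge_bounded x : `|co x| <= 1 /\ `|si x| <= 1.
Proof.
have := cs1 x; have := sqr_ge0 (co x); have := sqr_ge0 (si x) => s0 c0 E.
by split; rewrite -(@ler_sqr R) ?nnegrE// expr1n real_normK ?num_real//; lra.
Qed.

Let mco : measurable_fun setT co.
Proof. by apply: continuous_measurable_fun; exact: ACloc_continuous Aco. Qed.

Let msi : measurable_fun setT si.
Proof. by apply: continuous_measurable_fun; exact: ACloc_continuous Asi. Qed.

Let L2on_bdM (h f : R -> R) : measurable_fun setT h -> (forall x, `|h x| <= 1) ->
  L2on setT f -> L2on setT (fun x => h x * f x).
Proof.
move=> mh h1 Lf; apply: (L2on_le measurableT _ Lf).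
  by apply: measurable_funM => //; case: Lf.
by move=> x _; rewrite normrM ler_piMl.
Qed.

Lemma L2_ungauge u : L2 u -> L2on setT (ungauge1 u) /\ L2on setT (ungauge2 u).
Proof.
move=> [Lr Li]; have c1 x := (gauge_bounded x).1; have s1 x := (gauge_bounded x).2.
by split; [apply: L2onD|apply: L2onB] => //; exact: L2on_bdM.
Qed.

Lemma L2_gauge a b : L2on setT a -> L2on setT b -> L2 (gauge a b).
Proof.
move=> La Lb; have c1 x := (gauge_bounded x).1; have s1 x := (gauge_bounded x).2.
by split; [apply: L2onB|apply: L2onD] => //; exact: L2on_bdM.
Qed.

Lemma ip_ungauge u v : ip u v = Complex
  (\int[mu]_x (ungauge1 u x * ungauge1 v x + ungauge2 u x * ungauge2 v x))
  (\int[mu]_x (ungauge2 u x * ungauge1 v x - ungauge1 u x * ungauge2 v x)).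
Proof.
rewrite /ip; congr Complex; apply: eq_Rintegral => x _; rewrite /ungauge1 /ungauge2.
  transitivity ((co x ^+ 2 + si x ^+ 2) * (reF u x * reF v x + imF u x * imF v x)).
    by rewrite cs1 mul1r.
  by ring.
transitivity ((co x ^+ 2 + si x ^+ 2) * (imF u x * reF v x - reF u x * imF v x)).
  by rewrite cs1 mul1r.
by ring.
Qed.

Lemma nrm2_ungauge u : nrm2 u = \int[mu]_x (ungauge1 u x ^+ 2 + ungauge2 u x ^+ 2).
Proof.
apply: eq_Rintegral => x _; rewrite /ungauge1 /ungauge2.
transitivity ((co x ^+ 2 + si x ^+ 2) * (reF u x ^+ 2 + imF u x ^+ 2)).
  by rewrite cs1 mul1r.
by ring.
Qed.

(** Differentiating exp(-i theta) produces the factor - i r / p, which cancels the term + i r / p in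
    the equations for both u and u^[1]. What remains has real coefficients, so its real and
    imaginary parts solve the same system separately. *)
Lemma Lmax_ungauge u f : Lmax p Q r s u f -> exists u1 u2 : R -> R,
  sol (ungauge1 f) (ungauge1 u) u1 /\ sol (ungauge2 f) (ungauge2 u) u2.
Proof.
move=> [_ [Lf [du [u1 [du1 [[Aa Ab] [[Aa1 Ab1] [e1 e2]]]]]]]].
have p0 : {ae mu, forall x, p x != 0} by case: A => _ [_ [_ [_ [_ [_ [_ []]]]]]].
have e : {ae mu, forall x,
  [/\ reF du x = (p x)^-1 * reF u1 x + Q x / p x * reF u x - r x / p x * imF u x,
      imF du x = (p x)^-1 * imF u1 x + Q x / p x * imF u x + r x / p x * reF u x,
      reF du1 x = - reF f x - Q x / p x * reF u1 x - r x / p x * imF u1 x - be x * reF u x &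
      imF du1 x = - imF f x - Q x / p x * imF u1 x + r x / p x * reF u1 x - be x * imF u x]}.
  apply: ae_imp (ae_conj p0 (ae_conj e1 e2)) => x [px [E1 E2]].
  rewrite quasi_derivativeE in E1; rewrite quasi_expressionE in E2.
  rewrite /reF /imF; split.
  - by rewrite E1 /=; field.
  - by rewrite E1 /=; field.
  - by rewrite E2 /=; ring.
  - by rewrite E2 /=; ring.
have [m1 [m2 m3]] : measurable_fun setT P /\ measurable_fun setT al /\ measurable_fun setT be.
  by split; [|split]; [case: (Lloc1_inv_p A)|case: (Lloc1_Q_p A)|case: (Lloc1_potential A)].
have [[Mf1 _] [Mf2 _]] := L2_ungauge Lf.
have mC (h : R -> R) h' : ACloc h h' -> measurable_fun setT h.
  by move=> H; apply: continuous_measurable_fun; exact: ACloc_continuous H.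
have B1 := AClocD (AClocM Aco Aa) (AClocM Asi Ab).
have B2 := AClocB (AClocM Aco Ab) (AClocM Asi Aa).
have D1 := AClocD (AClocM Aco Aa1) (AClocM Asi Ab1).
have D2 := AClocB (AClocM Aco Ab1) (AClocM Asi Aa1).
have mm (g h h' : R -> R) k k' : measurable_fun setT g -> ACloc h k -> ACloc h' k' ->
    measurable_fun setT (fun x => - g x - al x * h x - be x * h' x).
  move=> mg Hh Hh'; apply: measurable_funB; last by apply: measurable_funM => //; exact: mC Hh'.
  apply: measurable_funB; last by apply: measurable_funM => //; exact: mC Hh.
  exact: measurableT_comp.
have mm' (h h' : R -> R) k k' : ACloc h k -> ACloc h' k' ->
    measurable_fun setT (fun x => (p x)^-1 * h x + al x * h' x).
  by move=> Hh Hh'; apply: measurable_funD; apply: measurable_funM => //;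
    [exact: mC Hh|exact: mC Hh'].
exists (ungauge1 u1), (ungauge2 u1); split; split.
- apply: ACloc_ae_eq B1 (mm' _ _ _ _ D1 B1) _.
  by apply: ae_imp e => x [-> -> _ _]; rewrite /ungauge1; ring.
- apply: ACloc_ae_eq D1 (mm _ _ _ _ _ Mf1 D1 B1) _.
  by apply: ae_imp e => x [_ _ -> ->]; rewrite /ungauge1; ring.
- apply: ACloc_ae_eq B2 (mm' _ _ _ _ D2 B2) _.
  by apply: ae_imp e => x [-> -> _ _]; rewrite /ungauge2; ring.
- apply: ACloc_ae_eq D2 (mm _ _ _ _ _ Mf2 D2 B2) _.
  by apply: ae_imp e => x [_ _ -> ->]; rewrite /ungauge2; ring.
Qed.

Lemma Lmax_gauge fa a a1 fb b b1 : sol fa a a1 -> sol fb b b1 ->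
  L2on setT a -> L2on setT b -> L2on setT fa -> L2on setT fb ->
  Lmax p Q r s (gauge a b) (gauge fa fb).
Proof.
move=> [Ha Ha1] [Hb Hb1] La Lb Lfa Lfb.
have p0 : {ae mu, forall x, p x != 0} by case: A => _ [_ [_ [_ [_ [_ [_ []]]]]]].
split; first exact: L2_gauge.
split; first exact: L2_gauge.
have B1 := AClocB (AClocM Aco Ha) (AClocM Asi Hb).
have B2 := AClocD (AClocM Asi Ha) (AClocM Aco Hb).
have D1 := AClocB (AClocM Aco Ha1) (AClocM Asi Hb1).
have D2 := AClocD (AClocM Asi Ha1) (AClocM Aco Hb1).
(* The derivatives are written exactly as the product rule delivers them in [B1], [B2], [D1] and
   [D2]. *)
exists (fun x => Complex (- (r x / p x * si x) * a x + co x * ((p x)^-1 * a1 x + Q x / p x * a x) -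
       (r x / p x * co x * b x + si x * ((p x)^-1 * b1 x + Q x / p x * b x)))
  (r x / p x * co x * a x + si x * ((p x)^-1 * a1 x + Q x / p x * a x) +
       (- (r x / p x * si x) * b x + co x * ((p x)^-1 * b1 x + Q x / p x * b x)))).
exists (gauge a1 b1).
exists (fun x => Complex (- (r x / p x * si x) * a1 x + co x * (- fa x - Q x / p x * a1 x - be x * a x) -
       (r x / p x * co x * b1 x + si x * (- fb x - Q x / p x * b1 x - be x * b x)))
  (r x / p x * co x * a1 x + si x * (- fa x - Q x / p x * a1 x - be x * a x) +
       (- (r x / p x * si x) * b1 x + co x * (- fb x - Q x / p x * b1 x - be x * b x)))).
split; first by split; [exact: B1|exact: B2].
split; first by split; [exact: D1|exact: D2].
split; apply: ae_imp p0 => x px.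
  by rewrite quasi_derivativeE /=; congr Complex; field.
by rewrite quasi_expressionE /=; congr Complex; field.
Qed.

End Gauge.
(** * Closures and adjoints *)

Section HilbertSpace.
Variable R : realType.
Local Notation mu := (@lebesgue_measure R).
Local Notation Cf := (R -> R[i]).
Implicit Types (u v w f g : Cf) (G : Cf -> Cf -> Prop).

Lemma reFB u v x : reF (fun y => u y - v y) x = reF u x - reF v x.
Proof. by rewrite /reF; case: (u x) => ? ?; case: (v x). Qed.

Lemma imFB u v x : imF (fun y => u y - v y) x = imF u x - imF v x.
Proof. by rewrite /imF; case: (u x) => ? ?; case: (v x). Qed.

Lemma L2B u v : L2 u -> L2 v -> L2 (fun x => u x - v x).
Proof.
move=> [a b] [c d]; split.
  by rewrite (_ : reF _ = (fun x => reF u x - reF v x)); [exact: L2onB|apply/funext => x; exact: reFB].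
by rewrite (_ : imF _ = (fun x => imF u x - imF v x)); [exact: L2onB|apply/funext => x; exact: imFB].
Qed.

Lemma nrm2_re_im u : L2 u ->
  nrm2 u = \int[mu]_x (reF u x ^+ 2) + \int[mu]_x (imF u x ^+ 2).
Proof. by move=> [[_ a] [_ b]]; rewrite /nrm2 RintegralD. Qed.

Lemma nrm2_ge0 u : 0 <= nrm2 u.
Proof. by apply: Rintegral_ge0 => x _; rewrite addr_ge0 ?sqr_ge0. Qed.

Lemma ip_conj u v : L2 u -> L2 v ->
  ip v u = Complex (complex.Re (ip u v)) (- complex.Im (ip u v)).
Proof.
move=> [ur ui] [vr vi]; rewrite /ip /=; congr Complex.
  by apply: eq_Rintegral => x _; ring.
have I1 := L2onM measurableT ui vr; have I2 := L2onM measurableT ur vi.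
rewrite -mulN1r -RintegralZl//; last exact: integrableB_EFin.
by apply: eq_Rintegral => x _; ring.
Qed.

(** Each component of the difference is a sum of two real integrals. Cauchy-Schwarz bounds each
    squared integral by the product of the norms, and squaring a sum of two gives the factor 4. *)
Lemma ip_dist u v w : L2 u -> L2 v -> L2 w ->
  (complex.Re (ip u w) - complex.Re (ip v w)) ^+ 2
    <= 4 * (nrm2 (fun x => u x - v x) * nrm2 w) /\
  (complex.Im (ip u w) - complex.Im (ip v w)) ^+ 2
    <= 4 * (nrm2 (fun x => u x - v x) * nrm2 w).
Proof.
move=> Lu Lv Lw; have [dr di] := L2B Lu Lv; have [wr wi] := Lw.
have [ur ui] := Lu; have [vr vi] := Lv.
set d := fun x => u x - v x in dr di *.
have N1 : nrm2 d = _ := nrm2_re_im (conj dr di).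
have N2 : nrm2 w = _ := nrm2_re_im Lw.
have H (a b a' b' : R -> R) : L2on setT a -> L2on setT b ->
    L2on setT a' -> L2on setT b' ->
    \int[mu]_x (a x ^+ 2) <= nrm2 d -> \int[mu]_x (b x ^+ 2) <= nrm2 w ->
    \int[mu]_x (a' x ^+ 2) <= nrm2 d -> \int[mu]_x (b' x ^+ 2) <= nrm2 w ->
    (\int[mu]_x (a x * b x) + \int[mu]_x (a' x * b' x)) ^+ 2 <= 4 * (nrm2 d * nrm2 w).
  move=> La Lb La' Lb' ad bw a'd b'w.
  have sq0 (k : R -> R) : 0 <= \int[mu]_x (k x ^+ 2).
    by apply: Rintegral_ge0 => x _; exact: sqr_ge0.
  have c1 : (\int[mu]_x (a x * b x)) ^+ 2 <= nrm2 d * nrm2 w.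
    by apply: (le_trans (L2_cauchy_schwarz La Lb)); exact: ler_pM.
  have c2 : (\int[mu]_x (a' x * b' x)) ^+ 2 <= nrm2 d * nrm2 w.
    by apply: (le_trans (L2_cauchy_schwarz La' Lb')); exact: ler_pM.
  have := sqr_ge0 (\int[mu]_x (a x * b x) - \int[mu]_x (a' x * b' x)).
  by move: c1 c2; nra.
have sq0 (k : R -> R) : 0 <= \int[mu]_x (k x ^+ 2).
  by apply: Rintegral_ge0 => x _; exact: sqr_ge0.
have [d1 d2 w1 w2] : [/\ \int[mu]_x (reF d x ^+ 2) <= nrm2 d,
    \int[mu]_x (imF d x ^+ 2) <= nrm2 d, \int[mu]_x (reF w x ^+ 2) <= nrm2 w &
    \int[mu]_x (imF w x ^+ 2) <= nrm2 w].
  by rewrite N1 N2; split; rewrite ?lerDl ?lerDr.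
have M := fun a b => @L2onM R setT a b measurableT.
split.
  rewrite [X in X ^+ 2 <= _](_ : _ = \int[mu]_x (reF d x * reF w x) +
     \int[mu]_x (imF d x * imF w x)); first exact: H.
  rewrite /ip /= -RintegralB// -?RintegralD//; try exact: M;
    try by apply: integrableD_EFin => //; exact: M.
  by apply: eq_Rintegral => x _; rewrite /d reFB imFB; ring.
rewrite [X in X ^+ 2 <= _](_ : _ = \int[mu]_x (imF d x * reF w x) +
   \int[mu]_x (reF d x * (- imF w x))).
  apply: H => //; first exact: L2onN.
  by under eq_Rintegral do rewrite sqrrN.
have nwi : L2on setT (fun x => - imF w x) by exact: L2onN.
rewrite /ip /= -RintegralB// -?RintegralD//; try exact: M;
  try by apply: integrableB_EFin => //; exact: M.
by apply: eq_Rintegral => x _; rewrite /d reFB imFB; ring.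
Qed.

(** The identity (f_k, v) = (u_k, w) passes to the limit by continuity of the inner product in its
    first argument. *)
Lemma adj_clos G v w : (forall u f, G u f -> L2 u /\ L2 f) ->
  adj G v w -> adj (clos G) v w.
Proof.
move=> GL [Lv [Lw H]]; split => //; split => // u f [Lu [Lf [us [fs [Gk [cu cf]]]]]].
have c0 : 8 * (nrm2 (fun x => fs k x - f x) * nrm2 v
    + nrm2 (fun x => us k x - u x) * nrm2 w) @[k --> \oo] --> (0 : R).
  rewrite [X in _ --> X](_ : 0 = 8 * (0 * nrm2 v + 0 * nrm2 w)).
    by apply: cvgM; [exact: cvg_cst|apply: cvgD; apply: cvgM; (try exact: cvg_cst)].
  by rewrite !mul0r addr0 mulr0.
have S (a : R) : (forall k, a ^+ 2 <= 8 * (nrm2 (fun x => fs k x - f x) * nrm2 v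
    + nrm2 (fun x => us k x - u x) * nrm2 w)) -> a = 0.
  move=> ak; apply/eqP; rewrite -sqrf_eq0 eq_le sqr_ge0 andbT.
  by apply: (cvgr_to_ge c0); apply: nearW.
(* Here c is a component of the common value (f_k, v) = (u_k, w), and a, b are the two limits to be
   identified. *)
have T (a b c : R) (X Y : R) : (c - a) ^+ 2 <= 4 * X -> (c - b) ^+ 2 <= 4 * Y ->
    (a - b) ^+ 2 <= 8 * (X + Y).
  by have := sqr_ge0 ((c - a) + (c - b)); nra.
have E : complex.Re (ip f v) = complex.Re (ip u w) /\ complex.Im (ip f v) = complex.Im (ip u w).
  split; apply/eqP; rewrite -subr_eq0; apply/eqP; apply: S => k;
    have [Lus Lfs] := GL _ _ (Gk k);
    have [r1 i1] := ip_dist Lfs Lf Lv; have [r2 i2] := ip_dist Lus Lu Lw;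
    rewrite -(H _ _ (Gk k)) in r2 i2.
  - exact: T r1 r2.
  - exact: T i1 i2.
by case: E; case: (ip f v) => ? ?; case: (ip u w) => ? ? /= -> ->.
Qed.

End HilbertSpace.

(** * Symmetry, adjoint and closure of the complex operators *)

Section Realization.
Variable R : realType.
Local Notation mu := (@lebesgue_measure R).
Local Notation Cf := (R -> R[i]).
Variables (p Q r s : R -> R).
Hypothesis A : standing_A p Q r s.

Local Notation P := (fun x => (p x)^-1).
Local Notation al := (fun x => Q x / p x).
Local Notation rho := (fun x => r x / p x).
Local Notation be := (fun x => (Q x ^+ 2 + r x ^+ 2) / p x - s x).
Local Notation sol := (qsol P al be).
Local Notation Lmax := (Lmax p Q r s).
Local Notation L00 := (L00 p Q r s).

Let IP := Lloc1_inv_p A.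
Let Ial := Lloc1_Q_p A.
Let Ibe := Lloc1_potential A.
Let P0 := ae_inv_p_neq0 A.

Let L2on0 : L2on setT (fun=> 0 : R).
Proof. by apply: (@L2on_compact _ _ 0) => // x; exact: cvg_cst. Qed.

Let sol0 : sol (fun=> 0) (fun=> 0) (fun=> 0).
Proof. by split; apply: ACloc_eq (ACloc_cst 0) => x //; ring. Qed.

(** The coefficient enters l with a minus sign, so adding k to it turns l into l - k. *)
Lemma qsol_shift k be' f u u1 : qsol P al be' f u u1 ->
  qsol P al (fun x => be' x + k) (fun x => f x - k * u x) u u1.
Proof. by move=> [h1 h2]; split => //; apply: ACloc_eq h2 => x //; ring. Qed.

(** The shift by k = gamma - 1 raises the lower bound to 1. Density of the range of l - k supplies u
    whose image is close to (l - k) v, and coercivity applied to u - v makes u close to v. *)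
Lemma real_approximation gamma K :
  (forall g u u1, sol g u u1 -> (exists M, forall x, M < `|x| -> u x = 0) ->
    L2on setT g -> gamma * \int[mu]_x (u x ^+ 2) <= \int[mu]_x (g x * u x)) ->
  0 <= K -> (forall M, exists phi kap psi dpsi, cutoff P al M K phi kap psi dpsi) ->
  forall f v v1 (ep : R), sol f v v1 -> L2on setT v -> L2on setT f -> 0 < ep ->
  exists u u1 g, [/\ sol g u u1, exists M, forall x, M < `|x| -> u x = 0,
    L2on setT g, \int[mu]_x ((g x - f x) ^+ 2) <= ep &
    \int[mu]_x ((u x - v x) ^+ 2) <= ep].
Proof.
move=> LB K0 cut f v v1 ep hv Lv Lf ep0.
pose k := gamma - 1; pose be' x := be x + k.
have Ibe' : Lloc1 be' by apply: Lloc1D => //; exact: Lloc1_cst.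
have back g u u1 : qsol P al be' g u u1 -> sol (fun x => g x + k * u x) u u1.
  by move=> [a1 a2]; split => //; apply: ACloc_eq a2 => x //; rewrite /be'; ring.
have LB' : sol_bounded_below P al be'.
  move=> g u u1 hu [M u0] Lg.
  have Lu : L2on setT u by apply: L2on_compact (qsol_continuous hu).1 u0.
  have Lg' : L2on setT (fun x => g x + k * u x) by apply: L2onD => //; exact: L2onZ.
  have := LB _ _ _ (back _ _ _ hu) (ex_intro _ M u0) Lg'.
  rewrite (_ : \int[mu]_x ((g x + k * u x) * u x) =
      \int[mu]_x (g x * u x) + k * \int[mu]_x (u x ^+ 2)); first by rewrite /k; lra.
  have Igu := L2onM measurableT Lg Lu; have Iuu := Lu.2.
  rewrite -RintegralZl// -RintegralD//; last exact: integrableZ_EFin.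
  by apply: eq_Rintegral => x _; ring.
have coer := @sol_coercive _ _ _ _ IP Ial Ibe' LB' K.
have {}coer g w w1 : qsol P al be' g w w1 -> L2on setT w -> L2on setT g ->
    \int[mu]_x (w x ^+ 2) <= \int[mu]_x (g x ^+ 2) by exact: coer.
have [y1 [Y1 [y2 [Y2 [h1 h2 i1 i2 W]]]]] := qsol_fundamental IP Ial Ibe'.
have hv' := qsol_shift k hv.
set f' := fun x => f x - k * v x in hv'.
have Lf' : L2on setT f' by apply: L2onB => //; exact: L2onZ.
(* Undoing the shift, l[u] - l[v] = (g' - f') + k (u - v), whose squared norm is at most (2 + 2 k^2)
   ep'. *)
pose ep' := ep / (2 + 2 * k ^+ 2).
have kp : 0 < 2 + 2 * k ^+ 2 by have := sqr_ge0 k; lra.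
have ep'0 : 0 < ep' by rewrite divr_gt0.
have ep'E : ep' * (2 + 2 * k ^+ 2) = ep by rewrite /ep' divfK// gt_eqF.
have [u [u1 [g' [hu [M u0] Lg' gf]]]] :=
  range_dense P0 h1 h2 i1 i2 W coer Lf' ep'0.
have Lu : L2on setT u by apply: L2on_compact (qsol_continuous hu).1 u0.
have Ld : L2on setT (fun x => 1 * u x + (-1) * v x) by apply: L2onD => //; exact: L2onZ.
have Lgd : L2on setT (fun x => 1 * g' x + (-1) * f' x) by apply: L2onD => //; exact: L2onZ.
have e1 x : 1 * u x + -1 * v x = u x - v x by ring.
have e2 x : 1 * g' x + -1 * f' x = g' x - f' x by ring.
have uv : \int[mu]_x ((u x - v x) ^+ 2) <= ep'.
  have := coer _ _ _ (qsol_lin 1 (-1) hu hv') Ld Lgd.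
  under eq_Rintegral do rewrite e1; under [leRHS]eq_Rintegral do rewrite e2.
  by move=> /le_trans; apply.
have epe : ep' <= ep by rewrite -ep'E; have := sqr_ge0 k; nra.
have Lg : L2on setT (fun x => g' x + k * u x) by apply: L2onD => //; exact: L2onZ.
exists u, u1, (fun x => g' x + k * u x); split => //; first exact: back.
- by exists M.
- have I1 : mu.-integrable setT (EFin \o (fun x => (g' x - f' x) ^+ 2)).
    by have [] := L2onB measurableT Lg' Lf'.
  have I2 : mu.-integrable setT (EFin \o (fun x => (u x - v x) ^+ 2)).
    by have [] := L2onB measurableT Lu Lv.
  have J1 := integrableZ_EFin 2 measurableT I1.
  have J2 := integrableZ_EFin (2 * k ^+ 2) measurableT I2.
  apply: (@le_trans _ _ (\int[mu]_x (2 * (g' x - f' x) ^+ 2 + 2 * k ^+ 2 * (u x - v x) ^+ 2))).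
    apply: le_Rintegral => //; first by have [] := L2onB measurableT Lg Lf.
      exact: integrableD_EFin.
    move=> x _.
    have -> : g' x + k * u x - f x = (g' x - f' x) + k * (u x - v x) by rewrite /f'; ring.
    by have := sqr_ge0 (g' x - f' x - k * (u x - v x)); nra.
  rewrite RintegralD// !RintegralZl// -ep'E.
  by have := sqr_ge0 k; nra.
- exact: le_trans epe.
Qed.

Variables (co si : R -> R).
Hypothesis Aco : ACloc co (fun x => - (rho x * si x)).
Hypothesis Asi : ACloc si (fun x => rho x * co x).
Hypothesis cs1 : forall x, co x ^+ 2 + si x ^+ 2 = 1.

Local Notation T1 := (ungauge1 co si).
Local Notation T2 := (ungauge2 co si).
Local Notation gauge := (gauge co si).

Let LT u : L2 u -> L2on setT (T1 u) /\ L2on setT (T2 u).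
Proof. exact: (L2_ungauge Aco Asi cs1). Qed.

Let T1K a b : T1 (gauge a b) = a.
Proof. by apply/funext => x; exact: (ungauge1K cs1). Qed.

Let T2K a b : T2 (gauge a b) = b.
Proof. by apply/funext => x; exact: (ungauge2K cs1). Qed.

Lemma gauge_L00 f u u1 g v v1 : sol f u u1 -> sol g v v1 ->
  (exists M, forall x, M < `|x| -> u x = 0 /\ v x = 0) ->
  L2on setT f -> L2on setT g -> L00 (gauge u v) (gauge f g).
Proof.
move=> hu hv [M H] Lf Lg; split; last first.
  exists M => x /H[u0 v0]; rewrite /gauge u0 v0 !mulr0 subrr addr0 //.
apply: (Lmax_gauge A Aco Asi cs1 hu hv) => //.
  by apply: (L2on_compact (qsol_continuous hu).1) => x /H[].
by apply: (L2on_compact (qsol_continuous hv).1) => x /H[].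
Qed.

(** The imaginary part of the inner product pairs the first component of one function with the
    second of the other; Green's formula covers these crossed pairs too, as both components obey one
    real system. *)
Lemma L00_symmetric u f v g : L00 u f -> Lmax v g -> ip f v = ip u g.
Proof.
move=> [Luf [M u0]] Lvg.
have [a1 [b1 [hu1 hu2]]] := Lmax_ungauge A Aco Asi cs1 Luf.
have [c1 [d1 [hv1 hv2]]] := Lmax_ungauge A Aco Asi cs1 Lvg.
have [Lu1 Lu2] := LT Luf.1; have [Lf1 Lf2] := LT Luf.2.1.
have [Lv1 Lv2] := LT Lvg.1; have [Lg1 Lg2] := LT Lvg.2.1.
have Z1 x : M < `|x| -> T1 u x = 0.
  by move=> /u0 E; rewrite /ungauge1 /reF /imF E !mulr0 addr0.
have Z2 x : M < `|x| -> T2 u x = 0.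
  by move=> /u0 E; rewrite /ungauge2 /reF /imF E !mulr0 subrr.
have I := fun h k => @L2onM R setT h k measurableT.
rewrite !(ip_ungauge cs1) !RintegralB ?RintegralD//; try exact: I.
rewrite (qsol_green P0 hu1 hv1 Z1) ?(qsol_green P0 hu2 hv2 Z2); try exact: I.
by rewrite (qsol_green P0 hu2 hv1 Z2) ?(qsol_green P0 hu1 hv2 Z1); try exact: I.
Qed.

(** Testing with a gauged pair whose second, respectively first, component is 0 and comparing real
    parts isolates each component of v, to which [qsol_adjoint] applies. Membership in the adjoint
    sees v only up to null sets, hence the continuous representative v'. *)
Lemma adj_L00_Lmax v w : adj L00 v w -> exists v', Lmax v' w /\ Defs.ae_eq v v'.
Proof.
move=> [Lv [Lw H]].
have [Lv1 Lv2] := LT Lv; have [Lw1 Lw2] := LT Lw.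
have [y1 [Y1 [y2 [Y2 [h1 h2 i1 i2 W]]]]] := qsol_fundamental IP Ial Ibe.
have E1 f u u1 : sol f u u1 -> (exists M, forall x, M < `|x| -> u x = 0) ->
    L2on setT f -> \int[mu]_x (f x * T1 v x) = \int[mu]_x (u x * T1 w x).
  move=> hu [M u0] Lf.
  have /H : L00 (gauge u (fun=> 0)) (gauge f (fun=> 0)).
    by apply: (gauge_L00 hu sol0) => //; exists M => x /u0.
  rewrite !(ip_ungauge cs1) !T1K !T2K => -[E _].
  transitivity (\int[mu]_x (f x * T1 v x + 0 * T2 v x)).
    by apply: eq_Rintegral => x _; ring.
  by rewrite E; apply: eq_Rintegral => x _; ring.
have E2 f u u1 : sol f u u1 -> (exists M, forall x, M < `|x| -> u x = 0) ->
    L2on setT f -> \int[mu]_x (f x * T2 v x) = \int[mu]_x (u x * T2 w x).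
  move=> hu [M u0] Lf.
  have /H : L00 (gauge (fun=> 0) u) (gauge (fun=> 0) f).
    by apply: (gauge_L00 sol0 hu) => //; exists M => x /u0.
  rewrite !(ip_ungauge cs1) !T1K !T2K => -[E _].
  transitivity (\int[mu]_x (0 * T1 v x + f x * T2 v x)).
    by apply: eq_Rintegral => x _; ring.
  by rewrite E; apply: eq_Rintegral => x _; ring.
have [a [a1 [ha va]]] := qsol_adjoint P0 IP Ial Ibe h1 h2 i1 i2 W Lv1 Lw1 E1.
have [b [b1 [hb vb]]] := qsol_adjoint P0 IP Ial Ibe h1 h2 i1 i2 W Lv2 Lw2 E2.
have La : L2on setT a.
  apply: L2on_ae_eq Lv1 _ va; apply: continuous_measurable_fun.
  exact: (qsol_continuous ha).1.
have Lb : L2on setT b.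
  apply: L2on_ae_eq Lv2 _ vb; apply: continuous_measurable_fun.
  exact: (qsol_continuous hb).1.
exists (gauge a b); split.
  have := Lmax_gauge A Aco Asi cs1 ha hb La Lb Lw1 Lw2.
  by rewrite (_ : gauge (T1 w) (T2 w) = w)//; apply/funext => x; exact: gaugeK.
apply: ae_imp (ae_conj va vb) => x [xa xb].
by rewrite -(gaugeK cs1 v x) /gauge xa xb.
Qed.

(** The two real components are approximated separately within 1 / (n + 1); the gauge is isometric,
    so their errors add up to 2 / (n + 1). The real lower bound comes from testing with gauged pairs
    whose second component is 0. *)
Lemma Lmax_clos_L00 K : bounded_below L00 -> 0 <= K ->
  (forall M, exists phi kap psi dpsi, cutoff P al M K phi kap psi dpsi) ->
  forall v f, Lmax v f -> clos L00 v f.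
Proof.
move=> [gamma LB] K0 cut v f Lvf.
have [c1 [d1 [hv1 hv2]]] := Lmax_ungauge A Aco Asi cs1 Lvf.
have [Lv1 Lv2] := LT Lvf.1; have [Lf1 Lf2] := LT Lvf.2.1.
have LBr g u u1 : sol g u u1 -> (exists M, forall x, M < `|x| -> u x = 0) ->
    L2on setT g -> gamma * \int[mu]_x (u x ^+ 2) <= \int[mu]_x (g x * u x).
  move=> hu [M u0] Lg.
  have /LB[_] : L00 (gauge u (fun=> 0)) (gauge g (fun=> 0)).
    by apply: (gauge_L00 hu sol0) => //; exists M => x /u0.
  rewrite (nrm2_ungauge cs1) (ip_ungauge cs1) !T1K !T2K /=.
  rewrite (_ : \int[mu]_x (u x ^+ 2 + 0 ^+ 2) = \int[mu]_x (u x ^+ 2)); last first.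
    by apply: eq_Rintegral => x _; ring.
  rewrite (_ : \int[mu]_x (g x * u x + 0 * 0) = \int[mu]_x (g x * u x))//.
  by apply: eq_Rintegral => x _; ring.
have ap := real_approximation LBr K0 cut.
split; first exact: Lvf.1; split; first exact: Lvf.2.1.
have step (n : nat) : exists uf : Cf * Cf, [/\ L00 uf.1 uf.2,
    nrm2 (fun x => uf.1 x - v x) <= 2 * n.+1%:R^-1 &
    nrm2 (fun x => uf.2 x - f x) <= 2 * n.+1%:R^-1].
  have n0 : 0 < n.+1%:R^-1 :> R by rewrite invr_gt0.
  have [a [a1 [fa [ha [Ma a0] Lfa da dfa]]]] := ap _ _ _ _ hv1 Lv1 Lf1 n0.
  have [b [b1 [fb [hb [Mb b0] Lfb db dfb]]]] := ap _ _ _ _ hv2 Lv2 Lf2 n0.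
  have La : L2on setT a by apply: L2on_compact (qsol_continuous ha).1 a0.
  have Lb : L2on setT b by apply: L2on_compact (qsol_continuous hb).1 b0.
  have N (h k : R -> R) w : L2on setT h -> L2on setT k -> L2 w ->
      \int[mu]_x ((h x - T1 w x) ^+ 2) <= n.+1%:R^-1 ->
      \int[mu]_x ((k x - T2 w x) ^+ 2) <= n.+1%:R^-1 ->
      nrm2 (fun x => gauge h k x - w x) <= 2 * n.+1%:R^-1.
    move=> Lh Lk /LT[Lw1 Lw2] hw kw; rewrite (nrm2_ungauge cs1).
    rewrite (_ : \int[mu]_x _ = \int[mu]_x ((h x - T1 w x) ^+ 2)
       + \int[mu]_x ((k x - T2 w x) ^+ 2)); first by rewrite mulr_natl mulr2n lerD.
    rewrite -RintegralD//; last 2 first.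
    - by have [] := L2onB measurableT Lh Lw1.
    - by have [] := L2onB measurableT Lk Lw2.
    apply: eq_Rintegral => x _; congr (_ ^+ 2 + _ ^+ 2).
      rewrite -[in RHS](ungauge1K cs1 h k x) /ungauge1 reFB imFB; ring.
    rewrite -[in RHS](ungauge2K cs1 h k x) /ungauge2 reFB imFB; ring.
  exists (gauge a b, gauge fa fb); split => /=.
  - apply: (gauge_L00 ha hb) => //; exists (Num.max Ma Mb) => x.
    by rewrite gt_max => /andP[/a0 ? /b0].
  - by apply: N => //; exact: Lvf.1.
  - by apply: N => //; exact: Lvf.2.1.
have [uf huf] := choice step.
have lim0 (e : nat -> R) : (forall n, 0 <= e n <= 2 * n.+1%:R^-1) -> e @ \oo --> (0 : R).
  move=> he; apply: (@squeeze_cvgr _ _ _ _ (fun=> 0) (fun n => 2 * n.+1%:R^-1)).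
  - by apply: nearW.
  - exact: cvg_cst.
  rewrite [X in _ --> X](_ : 0 = 2 * 0); last by rewrite mulr0.
  by apply: cvgM; [exact: cvg_cst|exact: cvg_harmonic].
exists (fun n => (uf n).1), (fun n => (uf n).2); split; first by move=> n; case: (huf n).
split; apply: lim0 => n; rewrite nrm2_ge0 /=; by case: (huf n).
Qed.

End Realization.

Theorem theorem2 (R : realType) (p Q r s : R -> R)
  (a b : int -> R) :
  standing_A p Q r s ->
  bounded_below (L00 p Q r s) ->
  (forall n, a n < b n) ->
  (forall M : R, exists N : int, forall n, n <= N -> b n < M) ->
  (forall M : R, exists N : int, forall n, N <= n -> M < a n) ->
  (exists C : R, 0 < C /\ forall n : int,
     exists pn dpn : R -> R,
       (* (i) p_n := p on Delta_n belongs to W^1_2(Delta_n):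
              pn is absolutely continuous on Delta_n with derivative dpn in L^2(Delta_n),
              and pn = p a.e. on Delta_n *)
       (@lebesgue_measure R).-integrable `[a n, b n] (EFin \o dpn) /\
       L2on `[a n, b n] dpn /\
       (forall x, a n <= x <= b n ->
          (\int[@lebesgue_measure R]_(t in `[a n, x]) (dpn t)%:E)%E
            = (pn x - pn (a n))%:E) /\
       {ae @lebesgue_measure R, forall x, a n <= x <= b n -> p x = pn x} /\
       (* (i) p_n > 0 and (ii) p_n <= C |Delta_n|^2 on Delta_n *)
       (forall x, a n <= x <= b n -> 0 < pn x /\ pn x <= C * (b n - a n) ^+ 2)) ->
  ess_self_adjoint (L00 p Q r s) /\
  op_eq (adj (L00 p Q r s)) (Lmax p Q r s) /\
  op_eq (Lmax p Q r s) (adj (Lmax p Q r s)).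
Proof.
move=> A LB ab bN aP [C [C0 hC]].
have [co [si [Aco Asi cs1]]] := gauge_exists A.
have K0 : 0 <= 9 / 4 * C by rewrite mulr_ge0// ltW.
have ramps n : exists phi kap psi dpsi, ramp p Q (a n) (b n) (9 / 4 * C) phi kap psi dpsi.
  have [pn [dpn [I1 [I2 [I3 [I4 I5]]]]]] := hC n.
  apply: (ramp_exists (Lloc1_Q_p A).1 _ (ab n) I1 I2 I3 I4 I5).
  by case: A => _ [_ [_ [_ [_ []]]]].
have cut M : exists phi kap psi dpsi,
    cutoff (fun x => (p x)^-1) (fun x => Q x / p x) M (9 / 4 * C) phi kap psi dpsi.
  have [N1 /(_ N1 (lexx _)) b1] := bN (- `|M|).
  have [N2 /(_ N2 (lexx _)) a2] := aP `|M|.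
  have [phi1 [kap1 [psi1 [dpsi1 r1]]]] := ramps N1.
  have [phi2 [kap2 [psi2 [dpsi2 r2]]]] := ramps N2.
  by do 4 eexists; exact: cutoff_of_ramps (ab N1) (ab N2) b1 a2 r1 r2.
have dense := Lmax_clos_L00 A Aco Asi cs1 LB K0 cut.
have sym := L00_symmetric A Aco Asi cs1.
have adjL := adj_L00_Lmax A Aco Asi cs1.
have L00L2 u f : L00 p Q r s u f -> L2 u /\ L2 f by move=> [[? [? _]] _].
have Lmax_adj v g : Lmax p Q r s v g -> adj (L00 p Q r s) v g.
  by move=> h; split; [exact: h.1|split; [exact: h.2.1|move=> u f /sym; exact]].
have Lmax_adj_clos v g : Lmax p Q r s v g -> adj (clos (L00 p Q r s)) v g.
  by move=> /Lmax_adj; exact: adj_clos.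
have refl (u : R -> R[i]) : Defs.ae_eq u u by exact: aeW.
have adj_ae v w : adj (L00 p Q r s) v w -> exists u' f',
    Lmax p Q r s u' f' /\ Defs.ae_eq v u' /\ Defs.ae_eq w f'.
  by move=> /adjL[v' [h e]]; exists v', w.
split; [split|split; split].
(* The closure is symmetric: elements of [L00] lie in the adjoint of the closure, conjugation
   exchanges the two arguments, and [adj_clos] extends the relation from [L00] to its closure. *)
- move=> u f cuf; exists u, f; split => //.
  have [Lu [Lf _]] := cuf; apply: adj_clos => //; split => //; split => // u0 f0 h0.
  have [Lu0 Lf0] := L00L2 _ _ h0.
  have [_ [_ /(_ _ _ cuf) E]] := Lmax_adj_clos _ _ h0.1.
  by rewrite (ip_conj Lu Lf0) (ip_conj Lf Lu0) E.
(* The adjoint of the closure lies in the adjoint of [L00], which lies in [Lmax] up to null sets,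
   and [dense] returns to the closure. *)
- move=> v w [Lv [Lw H]].
  have [|v' [w' [h e]]] := adj_ae v w.
    split => //; split => // u f h; apply: H.
    by apply: dense; exact: h.1.
  by exists v', w'; split => //; exact: dense.
- exact: adj_ae.
- by move=> v g h; exists v, g; split => //; exact: Lmax_adj.
(* Symmetry of [Lmax] against itself: one argument is placed in the closure of [L00] by [dense], the
   other in the adjoint of that closure. *)
- move=> v g h; exists v, g; split => //.
  split; [exact: h.1|split; [exact: h.2.1|move=> u f /dense]].
  by have [_ [_]] := Lmax_adj_clos _ _ h; apply.
- move=> v w [Lv [Lw H]]; apply: adj_ae.
  by split => //; split => // u f h; apply: H; exact: h.1.
Qed.
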